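(* Let $R$ be a commutative artin ring and $(\mathcal{C},\mathbb{E},\mathfrak{s})$ an $R$-linear Ext-finite extriangulated category which is weakly idempotent complete, has a right ARS duality $(\tau,\eta)$, and has enough projectives $\mathcal{Q}$ and enough injectives $\mathcal{J}$, both functorially finite in $\mathcal{C}$. Let $(\underline{\mathcal{C}},\underline{\mathbb{E}^{\mathcal{Q}}},\underline{\mathfrak{s}|_{\mathbb{E}^{\mathcal{Q}}}})$ (resp. $(\overline{\mathcal{C}},\overline{\mathbb{E}_{\mathcal{J}}},\overline{\mathfrak{s}|_{\mathbb{E}_{\mathcal{J}}}})$) be the ideal quotient of the relative theory $(\mathcal{C},\mathbb{E}^{\mathcal{Q}},\mathfrak{s}|_{\mathbb{E}^{\mathcal{Q}}})$ by $\mathcal{Q}$ (resp. of $(\mathcal{C},\mathbb{E}_{\mathcal{J}},\mathfrak{s}|_{\mathbb{E}_{\mathcal{J}}})$ by $\mathcal{J}$). Then there exists a natural isomorphism $\phi:\underline{\mathbb{E}^{\mathcal{Q}}}\Rightarrow\overline{\mathbb{E}_{\mathcal{J}}}\circ(\tau^{\rm op}\times\tau)$ such that $$(\tau,\phi):(\underline{\mathcal{C}},\underline{\mathbb{E}^{\mathcal{Q}}},\underline{\mathfrak{s}|_{\mathbb{E}^{\mathcal{Q}}}})\to(\overline{\mathcal{C}},\overline{\mathbb{E}_{\mathcal{J}}},\overline{\mathfrak{s}|_{\mathbb{E}_{\mathcal{J}}}})$$ is an exact functor which is fully faithful.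
   Context: $J$ is the minimal injective cogenerator of the category $\mathrm{mod}R$ of finitely generated $R$-modules and $\mathbb{D}=\mathrm{Hom}_R(-,J)$. Extriangulated categories (Nakaoka–Palu). An $R$-linear extriangulated category is a triplet $(\mathcal{C},\mathbb{E},\mathfrak{s})$ where $\mathcal{C}$ is an $R$-linear additive category, (ET1) $\mathbb{E}:\mathcal{C}^{\rm op}\times\mathcal{C}\to\mathrm{Mod}R$ is an $R$-bilinear functor, (ET2) $\mathfrak{s}$ is an additive realization of $\mathbb{E}$, and (ET3), (ET4) and their duals hold. For $\delta\in\mathbb{E}(C,A)$, $c:C'\to C$, $a:A\to A'$ write $c^*\delta=\mathbb{E}(c,A)(\delta)$, $a_*\delta=\mathbb{E}(C,a)(\delta)$. A morphism $\delta\to\delta'$ from $\delta\in\mathbb{E}(C,A)$ to $\delta'\in\mathbb{E}(C',A')$ is a pair $(a:A\to A',c:C\to C')$ with $a_*\delta=c^*\delta'$. An additive realization assigns to each $\delta\in\mathbb{E}(C,A)$ an equivalence class $\mathfrak{s}(\delta)=[A\to B\to C]$ (sequences equivalent if there is an isomorphism of middle terms compatible with $\mathrm{id}_A,\mathrm{id}_C$) such that each morphism $(a,c):\delta\to\delta'$ extends to a commutative diagram between realizing sequences, $\mathfrak{s}(0)=[A\to A\oplus C\to C]$, and $\mathfrak{s}(\delta\oplus\delta')=\mathfrak{s}(\delta)\oplus\mathfrak{s}(\delta')$. (ET3): if $\mathfrak{s}(\delta)=[A\xrightarrow{x}B\xrightarrow{y}C]$, $\mathfrak{s}(\delta')=[A'\xrightarrow{x'}B'\xrightarrow{y'}C']$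 and $bx=x'a$, there is $c$ with $cy=y'b$ and $(a,c):\delta\to\delta'$ a morphism. (ET4): if $\delta\in\mathbb{E}(D,A)$, $\delta'\in\mathbb{E}(F,B)$ are realized by $A\xrightarrow{f}B\xrightarrow{f'}D$, $B\xrightarrow{g}C\xrightarrow{g'}F$, there are $E$, $d:D\to E$, $e:E\to F$, $h'\colon C\to E$ and $\delta''\in\mathbb{E}(E,A)$ realized by $A\xrightarrow{h=gf}C\xrightarrow{h'}E$ with $h'g=df'$, $eh'=g'$, such that $D\xrightarrow{d}E\xrightarrow{e}F$ realizes $f'_*\delta'$, $d^*\delta''=\delta$, $f_*\delta''=e^*\delta'$. If $\mathfrak{s}(\delta)=[A\xrightarrow{a}B\xrightarrow{b}C]$, then $A\xrightarrow{a}B\xrightarrow{b}C\overset{\delta}{\dashrightarrow}$ is an $\mathfrak{s}$-triangle. Ext-finite: every $\mathbb{E}(C,A)$ is a finitely generated $R$-module. Weakly idempotent complete: every retraction in $\mathcal{C}$ has a kernel (equivalently every section has a cokernel). $P$ is projective if $\mathbb{E}(P,-)=0$; $\mathcal{C}$ has enough projectives if every $C$ admits an $\mathfrak{s}$-triangle $A\to P\to C\dashrightarrow$ with $P$ projective; injectives dually. ''Enough projectives $\mathcal{Q}$ / injectives $\mathcal{J}$'' means that $\mathcal{Q}$, $\mathcal{J}$ are the full subcategories of all projective, resp. injective, objects. ARS duality. $\mathcal{P}_{\mathbb{E}}$ (resp. $\mathcal{I}_{\mathbb{E}}$) is the ideal of morphisms $f$ with $\mathbb{E}(f,-)=0$ (resp.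 $\mathbb{E}(-,f)=0$); $\underline{\mathcal{C}}=\mathcal{C}/\mathcal{P}_{\mathbb{E}}$, $\overline{\mathcal{C}}=\mathcal{C}/\mathcal{I}_{\mathbb{E}}$; $\mathbb{E}$ induces $\underline{\mathcal{C}}^{\rm op}\times\overline{\mathcal{C}}\to\mathrm{Mod}R$. A right Auslander–Reiten–Serre (ARS) duality is a pair $(\tau,\eta)$ of an $R$-linear functor $\tau:\underline{\mathcal{C}}\to\overline{\mathcal{C}}$ and a binatural isomorphism of $R$-modules $\eta_{A,B}:\underline{\mathcal{C}}(A,B)\simeq\mathbb{D}\mathbb{E}(B,\tau A)$. With enough projectives $\mathcal{Q}$ and injectives $\mathcal{J}$, $\mathcal{P}_{\mathbb{E}}=[\mathcal{Q}]$ and $\mathcal{I}_{\mathbb{E}}=[\mathcal{J}]$, where $[\mathcal{X}]$ is the ideal of morphisms factoring through objects of $\mathcal{X}$. Relative structures. For a full subcategory $\mathcal{D}\subseteq\mathcal{C}$: $\mathbb{E}_{\mathcal{D}}(C,A)=\{\delta\in\mathbb{E}(C,A)\mid d^*\delta=0\ \forall d:D\to C,\ D\in\mathcal{D}\}$ and $\mathbb{E}^{\mathcal{D}}(C,A)=\{\delta\in\mathbb{E}(C,A)\mid d_*\delta=0\ \forall d:A\to D,\ D\in\mathcal{D}\}$. With the restrictions of $\mathfrak{s}$ these give extriangulated structures on $\mathcal{C}$ (relative theories). Objects of $\mathcal{Q}$ are projective and injective for $\mathbb{E}^{\mathcal{Q}}$, those of $\mathcal{J}$ for $\mathbb{E}_{\mathcal{J}}$.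 Ideal quotient. If all objects of a full additive subcategory $\mathcal{D}$ are both projective and injective in an extriangulated category $(\mathcal{C},\mathbb{G},\mathfrak{t})$, then $\mathcal{C}/[\mathcal{D}]$ is extriangulated with bifunctor induced by $\mathbb{G}$ (same values) and realization $[A\to B\to C]$ obtained from $\mathfrak{t}(\delta)$ by passing to classes of morphisms in $\mathcal{C}/[\mathcal{D}]$. Exact functor $(F,\phi):(\mathcal{C},\mathbb{E},\mathfrak{s})\to(\mathcal{C}',\mathbb{E}',\mathfrak{s}')$: an $R$-linear functor $F$ and a natural transformation $\phi:\mathbb{E}\Rightarrow\mathbb{E}'\circ(F^{\rm op}\times F)$ with $\mathfrak{s}'(\phi_{C,A}(\delta))=[FA\xrightarrow{Fx}FB\xrightarrow{Fy}FC]$ for every $\mathfrak{s}$-triangle $A\xrightarrow{x}B\xrightarrow{y}C\overset{\delta}{\dashrightarrow}$. *)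

(* Defs.v *)
From HB Require Import structures.
From mathcomp Require Import all_boot all_algebra.
From mathcomp Require Import boolp classical_sets.

Set Implicit Arguments.
Unset Strict Implicit.
Unset Printing Implicit Defensive.

Import GRing.Theory.

Local Open Scope ring_scope.
Local Open Scope classical_set_scope.
Local Open Scope quotient_scope.

Section Submodules.
Variables (R : comPzRingType) (V : lmodType R).

Record submodule := Submodule {
  smem :> V -> Prop;
  smem0 : smem 0;
  smem_lin : forall (a : R) (x y : V), smem x -> smem y -> smem (a *: x + y) }.

Lemma smemZ (N : submodule) a x : N x -> N (a *: x).
Proof.
by move=> Nx; rewrite -[a *: x]addr0; apply: smem_lin => //; apply: smem0.
Qed.

Lemma smemD (N : submodule) x y : N x -> N y -> N (x + y).
Proof. by move=> Nx Ny; rewrite -[x]scale1r; apply: smem_lin. Qed.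

Definition spred (N : submodule) : {pred V} := fun x => `[< N x >].

Lemma spred_closed (N : submodule) : submod_closed (spred N).
Proof.
split; first exact/asboolP/smem0.
by move=> a x y /asboolP Nx /asboolP Ny; apply/asboolP/smem_lin.
Qed.

HB.instance Definition _ (N : submodule) :=
  GRing.isSubmodClosed.Build R V (spred N) (@spred_closed N).

Record subm (N : submodule) := SubM { subm_val :> V; subm_valP : subm_val \in spred N }.

Section SubmLmodule.
Variable N : submodule.

HB.instance Definition _ := [isSub for @subm_val N].
HB.instance Definition _ := [Choice of subm N by <:].
HB.instance Definition _ := GRing.SubChoice_isSubLmodule.Build R V (spred N)
  (subm N) (GRing.submod_closed_semi (spred_closed N)).

End SubmLmodule.

Lemma subm_mem (N : submodule) (x : subm N) : N (subm_val x).
Proof. exact/asboolP/(subm_valP x). Qed.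

Definition mk_subm (N : submodule) (x : V) (Nx : N x) : subm N :=
  @SubM N x (asboolT Nx).

(** V / N, on top of the quotient of abelian groups. *)
Definition quotm (N : submodule) : Type := Quotient.quot (spred N).

HB.instance Definition _ (N : submodule) := GRing.Zmodule.on (quotm N).

Definition cl (N : submodule) (x : V) : quotm N :=
  \pi_(Quotient.quot (spred N)) x.

Definition rep (N : submodule) (c : quotm N) : V :=
  repr (c : Quotient.quot (spred N)).

Lemma repK (N : submodule) (c : quotm N) : cl N (rep c) = c.
Proof. exact: reprK. Qed.

Lemma cl_eqP (N : submodule) (x y : V) : cl N x = cl N y <-> N (x - y).
Proof.
rewrite /cl; split=> [/eqP|H]; last apply/eqP; rewrite -Quotient.idealrBE.
  by move/asboolP.
exact/asboolP.
Qed.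

Lemma clB (N : submodule) : {morph cl N : x y / x - y}.
Proof. exact: pi_is_zmod_morphism. Qed.

Lemma cl0 (N : submodule) : cl N 0 = 0.
Proof. by rewrite -[0 in LHS](subrr 0) clB subrr. Qed.

Lemma clD (N : submodule) : {morph cl N : x y / x + y}.
Proof. by move=> x y; rewrite -[y in LHS]opprK -[- y]sub0r !clB cl0 sub0r opprK. Qed.

Definition quotm_scale (N : submodule) (a : R) (c : quotm N) : quotm N :=
  cl N (a *: rep c).

Lemma quotm_scaleE (N : submodule) a x :
  quotm_scale a (cl N x) = cl N (a *: x).
Proof.
by apply/cl_eqP; rewrite -scalerBr; apply/smemZ/cl_eqP; rewrite repK.
Qed.

Section QuotmLmodule.
Variable N : submodule.

Fact quotm_scaleA a b (v : quotm N) :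
  quotm_scale a (quotm_scale b v) = quotm_scale (a * b) v.
Proof. by rewrite -(repK v) !quotm_scaleE scalerA. Qed.

Fact quotm_scale1 : left_id 1 (@quotm_scale N).
Proof. by move=> v; rewrite -(repK v) quotm_scaleE scale1r. Qed.

Fact quotm_scaleDr : right_distributive (@quotm_scale N) +%R.
Proof.
by move=> a u v; rewrite -(repK u) -(repK v) -clD !quotm_scaleE scalerDr clD.
Qed.

Fact quotm_scaleDl (v : quotm N) :
  {morph (@quotm_scale N)^~ v : a b / a + b}.
Proof. by move=> a b; rewrite -(repK v) !quotm_scaleE scalerDl clD. Qed.

HB.instance Definition _ := GRing.Zmodule_isLmodule.Build R (quotm N)
  quotm_scaleA quotm_scale1 quotm_scaleDr quotm_scaleDl.

End QuotmLmodule.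

Lemma cl_linear (N : submodule) : linear (cl N).
Proof. by move=> a x y; rewrite clD -quotm_scaleE. Qed.

HB.instance Definition _ (N : submodule) :=
  GRing.isLinear.Build R V (quotm N) _ (cl N) (@cl_linear N).

End Submodules.

Section HomModule.
Variables (R : comPzRingType) (M N : lmodType R).

Definition homm : Type := {linear M -> N}.

HB.instance Definition _ := gen_eqMixin homm.
HB.instance Definition _ := gen_choiceMixin homm.

Definition homm_fun (f : homm) : M -> N := (f : {linear M -> N}).
Coercion homm_fun : homm >-> Funclass.

Lemma hommP (f g : homm) : f =1 g -> f = g.
Proof.
case: f g => [f Lf] [g Lg] /funext /= fg.
rewrite /homm_fun /= in fg; subst g; congr GRing.Linear.Pack.
case: Lf Lg => [[f1] [f2]] [[g1] [g2]].
by rewrite (Prop_irrelevance f1 g1) (Prop_irrelevance f2 g2).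
Qed.

Definition homm0 : homm := \0 : {linear M -> N}.
Definition hommN (f : homm) : homm := (\- f : {linear M -> N}).
Definition hommD (f g : homm) : homm := (f \+ g : {linear M -> N}).
Definition hommZ (a : R) (f : homm) : homm := (a \*: f : {linear M -> N}).

Fact hommDA : associative hommD.
Proof. by move=> f g h; apply: hommP => x; apply: addrA. Qed.
Fact hommDC : commutative hommD.
Proof. by move=> f g; apply: hommP => x; apply: addrC. Qed.
Fact homm0D : left_id homm0 hommD.
Proof. by move=> f; apply: hommP => x; apply: add0r. Qed.
Fact hommND : left_inverse homm0 hommN hommD.
Proof. by move=> f; apply: hommP => x; apply: addNr. Qed.
HB.instance Definition _ := GRing.isZmodule.Build homm hommDA hommDC homm0D hommND.

Fact hommZA a b f : hommZ a (hommZ b f) = hommZ (a * b) f.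
Proof. by apply: hommP => x; apply: scalerA. Qed.
Fact hommZ1 : left_id 1 hommZ.
Proof. by move=> f; apply: hommP => x; apply: scale1r. Qed.
Fact hommZDr : right_distributive hommZ +%R.
Proof. by move=> a f g; apply: hommP => x; apply: scalerDr. Qed.
Fact hommZDl f : {morph hommZ^~ f : a b / a + b}.
Proof. by move=> a b; apply: hommP => x; apply: scalerDl. Qed.
HB.instance Definition _ :=
  GRing.Zmodule_isLmodule.Build R homm hommZA hommZ1 hommZDr hommZDl.

End HomModule.

Definition artinian (R : comPzRingType) : Prop :=
  forall I : nat -> submodule (R^o : lmodType R),
    (forall n x, I n.+1 x -> I n x) ->
    exists n, forall m, (n <= m)%N -> forall x, I m x <-> I n x.

Definition finitely_generated (R : comPzRingType) (M : lmodType R) : Prop :=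
  exists n (v : 'I_n -> M), forall x : M,
    exists c : 'I_n -> R, x = \sum_(i < n) c i *: v i.

Section InjectiveCogenerator.
Variables (R : comPzRingType) (J : lmodType R).

Definition injective_in_mod : Prop :=
  finitely_generated J /\
  forall (M N : lmodType R) (i : {linear M -> N}) (f : {linear M -> J}),
    finitely_generated M -> finitely_generated N -> injective i ->
    exists g : {linear N -> J}, forall x, g (i x) = f x.

Definition cogenerator_of_mod : Prop :=
  finitely_generated J /\
  forall (M N : lmodType R) (f : {linear M -> N}),
    finitely_generated M -> finitely_generated N -> (exists x, f x <> 0) ->
    exists (g : {linear N -> J}) x, g (f x) <> 0.

End InjectiveCogenerator.

(** Minimality: no proper submodule of J is again an injective cogenerator. *)
Definition minimal_injective_cogenerator (R : comPzRingType) (J : lmodType R) :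
    Prop :=
  [/\ injective_in_mod J, cogenerator_of_mod J &
    forall N : submodule J,
      injective_in_mod (subm N : lmodType R) ->
      cogenerator_of_mod (subm N : lmodType R) -> forall x, N x].

Record lincat (R : comPzRingType) := LinCat {
  obj :> Type;
  mor : obj -> obj -> lmodType R;
  idm : forall A, mor A A;
  mcomp : forall A B C, mor B C -> mor A B -> mor A C;
  compA : forall A B C D (h : mor C D) (g : mor B C) (f : mor A B),
    mcomp h (mcomp g f) = mcomp (mcomp h g) f;
  comp1m : forall A B (f : mor A B), mcomp (idm B) f = f;
  compm1 : forall A B (f : mor A B), mcomp f (idm A) = f;
  comp_linl : forall A B C (f : mor A B), linear (fun g : mor B C => mcomp g f);
  comp_linr : forall A B C (g : mor B C), linear (fun f : mor A B => mcomp g f) }.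

Arguments idm {R l} A.
Arguments mcomp {R l A B C} g f.
Notation "g \@ f" := (mcomp g f) (at level 40, left associativity).

Section Lincat.
Variables (R : comPzRingType) (C : lincat R).

Lemma compBl (A B D : C) (f : mor A B) (g g' : mor B D) :
  (g - g') \@ f = g \@ f - g' \@ f.
Proof. exact: (GRing.zmod_morphism_linear (comp_linl f)). Qed.

Lemma compBr (A B D : C) (g : mor B D) (f f' : mor A B) :
  g \@ (f - f') = g \@ f - g \@ f'.
Proof. exact: (GRing.zmod_morphism_linear (comp_linr g)). Qed.

Lemma comp0m (A B D : C) (f : mor A B) : (0 : mor B D) \@ f = 0.
Proof. by rewrite -(subrr 0) compBl subrr. Qed.

Lemma compm0 (A B D : C) (g : mor B D) : g \@ (0 : mor A B) = 0.
Proof. by rewrite -(subrr 0) compBr subrr. Qed.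

Lemma compDl (A B D : C) (f : mor A B) (g g' : mor B D) :
  (g + g') \@ f = g \@ f + g' \@ f.
Proof. by have := comp_linl f 1 g g'; rewrite !scale1r. Qed.

Lemma compDr (A B D : C) (g : mor B D) (f f' : mor A B) :
  g \@ (f + f') = g \@ f + g \@ f'.
Proof. by have := comp_linr g 1 f f'; rewrite !scale1r. Qed.

Definition is_iso (A B : C) (f : mor A B) : Prop :=
  exists g : mor B A, g \@ f = idm A /\ f \@ g = idm B.

Record biproduct (A B : C) := Biproduct {
  bobj :> C;
  binj1 : mor A bobj;
  binj2 : mor B bobj;
  bpr1 : mor bobj A;
  bpr2 : mor bobj B;
  bpr1_in1 : bpr1 \@ binj1 = idm A;
  bpr2_in2 : bpr2 \@ binj2 = idm B;
  bpr1_in2 : bpr1 \@ binj2 = 0;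
  bpr2_in1 : bpr2 \@ binj1 = 0;
  bin_pr : binj1 \@ bpr1 + binj2 \@ bpr2 = idm bobj }.

Definition bsum (A A' B B' : C) (S : biproduct A A') (T : biproduct B B')
    (f : mor A B) (g : mor A' B') : mor S T :=
  binj1 T \@ f \@ bpr1 S + binj2 T \@ g \@ bpr2 S.

Definition additive_cat : Prop :=
  (exists Z : C, idm Z = 0) /\ (forall A B : C, inhabited (biproduct A B)).

Definition is_kernel (K A B : C) (k : mor K A) (f : mor A B) : Prop :=
  f \@ k = 0 /\
  forall (X : C) (g : mor X A), f \@ g = 0 -> exists! u : mor X K, k \@ u = g.

Definition weakly_idempotent_complete : Prop :=
  forall (A B : C) (r : mor A B),
    (exists s : mor B A, r \@ s = idm B) ->
    exists (K : C) (k : mor K A), is_kernel k r.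

(** Throughout, a full subcategory is given by its set of objects. *)
Definition factors_through (D : set C) (A B : C) (f : mor A B) : Prop :=
  exists (X : C) (g : mor A X) (h : mor X B), D X /\ f = h \@ g.

Definition contravariantly_finite (D : set C) : Prop :=
  forall A : C, exists (X : C) (f : mor X A), D X /\
    forall (Y : C) (g : mor Y A), D Y -> exists u : mor Y X, f \@ u = g.

Definition covariantly_finite (D : set C) : Prop :=
  forall A : C, exists (X : C) (f : mor A X), D X /\
    forall (Y : C) (g : mor A Y), D Y -> exists u : mor X Y, u \@ f = g.

Definition functorially_finite (D : set C) : Prop :=
  contravariantly_finite D /\ covariantly_finite D.

Record sequence (A A'' : C) := Sequence {
  mid : C;
  sfst : mor A mid;
  ssnd : mor mid A'' }.

Definition seq_equiv (A A'' : C) (s t : sequence A A'') : Prop :=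
  exists b : mor (mid s) (mid t),
    [/\ is_iso b, b \@ sfst s = sfst t & ssnd t \@ b = ssnd s].

Lemma is_iso_comp (A B D : C) (g : mor B D) (f : mor A B) :
  is_iso g -> is_iso f -> is_iso (g \@ f).
Proof.
move=> [g' [g'g gg']] [f' [f'f ff']]; exists (f' \@ g'); split.
  by rewrite -compA (compA g') g'g comp1m.
by rewrite -compA (compA f) ff' comp1m.
Qed.

Lemma seq_equiv_refl (A A'' : C) (s : sequence A A'') : seq_equiv s s.
Proof.
exists (idm _); rewrite comp1m compm1; split=> //.
by exists (idm _); rewrite comp1m.
Qed.

Lemma seq_equiv_sym (A A'' : C) (s t : sequence A A'') :
  seq_equiv s t -> seq_equiv t s.
Proof.
move=> [b [[b' [b'b bb']] bx yb]]; exists b'; split.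
- by exists b.
- by rewrite -bx compA b'b comp1m.
- by rewrite -yb -compA bb' compm1.
Qed.

Lemma seq_equiv_trans (A A'' : C) (s t u : sequence A A'') :
  seq_equiv s t -> seq_equiv t u -> seq_equiv s u.
Proof.
move=> [b [ib bx yb]] [c [ic cx yc]]; exists (c \@ b); split.
- exact: is_iso_comp.
- by rewrite -compA bx cx.
- by rewrite compA yc yb.
Qed.

End Lincat.

Record linfunctor (R : comPzRingType) (C D : lincat R) := LinFunctor {
  fobj :> C -> D;
  fmap : forall A B : C, {linear mor A B -> mor (fobj A) (fobj B)};
  fmap1 : forall A : C, fmap A A (idm A) = idm (fobj A);
  fmap_comp : forall (A B E : C) (g : mor B E) (f : mor A B),
    fmap A E (g \@ f) = fmap B E g \@ fmap A B f }.

Arguments fmap {R C D} l {A B}.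

Section Functors.
Variables (R : comPzRingType) (C D : lincat R) (F : linfunctor C D).

Definition fully_faithful : Prop :=
  forall A B : C, bijective (fmap F : mor A B -> mor (F A) (F B)).

Definition map_sequence (A A'' : C) (s : sequence A A'') :
    sequence (F A) (F A'') :=
  Sequence (fmap F (sfst s)) (fmap F (ssnd s)).

Lemma map_sequence_equiv (A A'' : C) (s t : sequence A A'') :
  seq_equiv s t -> seq_equiv (map_sequence s) (map_sequence t).
Proof.
move=> [b [[b' [b'b bb']] bx yb]]; exists (fmap F b); split.
- by exists (fmap F b'); rewrite -!fmap_comp b'b bb' !fmap1.
- by rewrite /= -fmap_comp bx.
- by rewrite /= -fmap_comp yb.
Qed.

End Functors.

(** R-bilinear functors C^op x D -> Mod R. For [E : bifun C D], the module
    [E X Y] is contravariant in [X] (through [pull], usually written c^* )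
    and covariant in [Y] (through [push], usually written a_* ). *)
Record bifun (R : comPzRingType) (C D : lincat R) := Bifun {
  ext :> C -> D -> lmodType R;
  pull : forall (X X' : C) (Y : D), mor X' X -> ext X Y -> ext X' Y;
  push : forall (X : C) (Y Y' : D), mor Y Y' -> ext X Y -> ext X Y';
  pull_lin : forall X X' Y (c : mor X' X), linear (@pull X X' Y c);
  push_lin : forall X Y Y' (a : mor Y Y'), linear (@push X Y Y' a);
  pull_linm : forall X X' Y (d : ext X Y),
    linear (fun c : mor X' X => pull c d);
  push_linm : forall X Y Y' (d : ext X Y),
    linear (fun a : mor Y Y' => push a d);
  pull1 : forall X Y (d : ext X Y), pull (idm X) d = d;
  push1 : forall X Y (d : ext X Y), push (idm Y) d = d;
  pull_comp : forall X X' X'' Y (c : mor X' X) (c' : mor X'' X') (d : ext X Y),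
    pull (c \@ c') d = pull c' (pull c d);
  push_comp : forall X Y Y' Y'' (a : mor Y Y') (a' : mor Y' Y'') (d : ext X Y),
    push (a' \@ a) d = push a' (push a d);
  push_pull : forall X X' Y Y' (c : mor X' X) (a : mor Y Y') (d : ext X Y),
    push a (pull c d) = pull c (push a d) }.

Arguments pull {R C D} b {X X' Y} c d.
Arguments push {R C D} b {X Y Y'} a d.

Section BifunLinear.
Variables (R : comPzRingType) (C D : lincat R) (E : bifun C D).

Lemma pullB X X' Y (c : mor X' X) (d d' : E X Y) :
  pull E c (d - d') = pull E c d - pull E c d'.
Proof. exact: (GRing.zmod_morphism_linear (pull_lin c)). Qed.

Lemma pushB X Y Y' (a : mor Y Y') (d d' : E X Y) :
  push E a (d - d') = push E a d - push E a d'.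
Proof. exact: (GRing.zmod_morphism_linear (push_lin a)). Qed.

Lemma pullBm X X' Y (c c' : mor X' X) (d : E X Y) :
  pull E (c - c') d = pull E c d - pull E c' d.
Proof. exact: (GRing.zmod_morphism_linear (pull_linm d)). Qed.

Lemma pushBm X Y Y' (a a' : mor Y Y') (d : E X Y) :
  push E (a - a') d = push E a d - push E a' d.
Proof. exact: (GRing.zmod_morphism_linear (push_linm d)). Qed.

Lemma pull0 X X' Y (c : mor X' X) : pull E c (0 : E X Y) = 0.
Proof. by rewrite -(subrr 0) pullB subrr. Qed.

Lemma push0 X Y Y' (a : mor Y Y') : push E a (0 : E X Y) = 0.
Proof. by rewrite -(subrr 0) pushB subrr. Qed.

Lemma pull0m X X' Y (d : E X Y) : pull E (0 : mor X' X) d = 0.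
Proof. by rewrite -(subrr 0) pullBm subrr. Qed.

Lemma push0m X Y Y' (d : E X Y) : push E (0 : mor Y Y') d = 0.
Proof. by rewrite -(subrr 0) pushBm subrr. Qed.

End BifunLinear.

Section BifunComp.
Variables (R : comPzRingType) (C D C' D' : lincat R).
Variables (E : bifun C' D') (F : linfunctor C C') (G : linfunctor D D').

(** E o (F^op x G) *)
Definition bifun_comp : bifun C D.
Proof.
refine (@Bifun R C D (fun X Y => E (F X) (G Y))
  (fun X X' Y c d => pull E (fmap F c) d)
  (fun X Y Y' a d => push E (fmap G a) d) _ _ _ _ _ _ _ _ _).
- by move=> X X' Y c; apply: pull_lin.
- by move=> X Y Y' c; apply: push_lin.
- by move=> X X' Y d a f g; rewrite linearP; apply: pull_linm.
- by move=> X Y Y' d a f g; rewrite linearP; apply: push_linm.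
- by move=> X Y d; rewrite fmap1 pull1.
- by move=> X Y d; rewrite fmap1 push1.
- by move=> *; rewrite fmap_comp pull_comp.
- by move=> *; rewrite fmap_comp push_comp.
- by move=> *; rewrite push_pull.
Defined.

End BifunComp.

Record bifun_trans (R : comPzRingType) (C D : lincat R) (E E' : bifun C D) :=
  BifunTrans {
    btrans :> forall X Y, {linear E X Y -> E' X Y};
    btrans_pull : forall X X' Y (c : mor X' X) (d : E X Y),
      btrans X' Y (pull E c d) = pull E' c (btrans X Y d);
    btrans_push : forall X Y Y' (a : mor Y Y') (d : E X Y),
      btrans X Y' (push E a d) = push E' a (btrans X Y d) }.

Definition is_bifun_iso (R : comPzRingType) (C D : lincat R) (E E' : bifun C D)
    (phi : bifun_trans E E') : Prop :=
  forall X Y, bijective (phi X Y).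

Record ideal (R : comPzRingType) (C : lincat R) := Ideal {
  imem :> forall A B : C, submodule (mor A B);
  ideal_compl : forall (A B D : C) (g : mor B D) (f : mor A B),
    imem A B f -> imem A D (g \@ f);
  ideal_compr : forall (A B D : C) (g : mor B D) (f : mor A B),
    imem B D g -> imem A D (g \@ f) }.

Section QuotientCategory.
Variables (R : comPzRingType) (C : lincat R) (I : ideal C).

Lemma comp_mod (A B D : C) (g g' : mor B D) (f f' : mor A B) :
  cl (I B D) g = cl (I B D) g' -> cl (I A B) f = cl (I A B) f' ->
  cl (I A D) (g \@ f) = cl (I A D) (g' \@ f').
Proof.
move=> /cl_eqP Ig /cl_eqP If; apply/cl_eqP.
have -> : g \@ f - g' \@ f' = (g - g') \@ f + g' \@ (f - f').
  by rewrite compBl compBr addrA subrK.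
by apply: smemD; [apply: ideal_compr | apply: ideal_compl].
Qed.

Definition quot_hom (A B : C) : lmodType R := quotm (I A B).

Definition quot_comp (A B D : C) (g : quot_hom B D) (f : quot_hom A B) :
    quot_hom A D :=
  cl (I A D) (rep g \@ rep f).

Lemma quot_compE (A B D : C) (g : mor B D) (f : mor A B) :
  quot_comp (cl (I B D) g) (cl (I A B) f) = cl (I A D) (g \@ f).
Proof. by apply: comp_mod; rewrite repK. Qed.

Definition quot_cat : lincat R.
Proof.
refine (@LinCat R C quot_hom (fun A => cl (I A A) (idm A)) quot_comp
  _ _ _ _ _).
- move=> A B D F h g f; rewrite -(repK h) -(repK g) -(repK f).
  by rewrite !quot_compE compA.
- by move=> A B f; rewrite -(repK f) quot_compE comp1m.
- by move=> A B f; rewrite -(repK f) quot_compE compm1.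
- move=> A B D f a g g'; rewrite -(repK f) -(repK g) -(repK g').
  by rewrite -linearP !quot_compE comp_linl linearP.
- move=> A B D g a f f'; rewrite -(repK g) -(repK f) -(repK f').
  by rewrite -linearP !quot_compE comp_linr linearP.
Defined.

Definition quot_proj : linfunctor C quot_cat.
Proof.
refine (@LinFunctor R C quot_cat (fun A => A)
  (fun A B => cl (I A B) : {linear mor A B -> quotm (I A B)}) _ _).
- by [].
- by move=> A B D g f; rewrite /= quot_compE.
Defined.

End QuotientCategory.

(** The bifunctor (C / I)^op x (D / I') -> Mod R induced by a bifunctor on
    which I and I' act as zero. *)
Section QuotientBifun.
Variables (R : comPzRingType) (C D : lincat R) (E : bifun C D).
Variables (I : ideal C) (I' : ideal D).
Hypothesis I_zero : forall X X' Y (c : mor X' X) (d : E X Y),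
  I X' X c -> pull E c d = 0.
Hypothesis I'_zero : forall X Y Y' (a : mor Y Y') (d : E X Y),
  I' Y Y' a -> push E a d = 0.

Definition quot_pull X X' Y (c : quot_hom I X' X) (d : E X Y) : E X' Y :=
  pull E (rep c) d.

Definition quot_push X Y Y' (a : quot_hom I' Y Y') (d : E X Y) : E X Y' :=
  push E (rep a) d.

Lemma quot_pullE X X' Y (c : mor X' X) (d : E X Y) :
  quot_pull (cl (I X' X) c) d = pull E c d.
Proof.
apply/subr0_eq; rewrite /quot_pull -pullBm; apply: I_zero.
by apply/cl_eqP; rewrite repK.
Qed.

Lemma quot_pushE X Y Y' (a : mor Y Y') (d : E X Y) :
  quot_push (cl (I' Y Y') a) d = push E a d.
Proof.
apply/subr0_eq; rewrite /quot_push -pushBm; apply: I'_zero.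
by apply/cl_eqP; rewrite repK.
Qed.

Definition quot_bifun : bifun (quot_cat I) (quot_cat I').
Proof.
refine (@Bifun R (quot_cat I) (quot_cat I') (fun X Y => E X Y)
  quot_pull quot_push _ _ _ _ _ _ _ _ _).
- by move=> X X' Y c; apply: pull_lin.
- by move=> X Y Y' a; apply: push_lin.
- move=> X X' Y d a c c'; rewrite -(repK c) -(repK c') -linearP !quot_pullE.
  exact: pull_linm.
- move=> X Y Y' d a c c'; rewrite -(repK c) -(repK c') -linearP !quot_pushE.
  exact: push_linm.
- by move=> X Y d; rewrite quot_pullE pull1.
- by move=> X Y d; rewrite quot_pushE push1.
- move=> X X' X'' Y c c' d; rewrite -(repK c) -(repK c') [_ \@ _]quot_compE.
  by rewrite !quot_pullE pull_comp.
- move=> X Y Y' Y'' c c' d; rewrite -(repK c) -(repK c') [_ \@ _]quot_compE.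
  by rewrite !quot_pushE push_comp.
- by move=> X X' Y Y' c a d; apply: push_pull.
Defined.

End QuotientBifun.

(** The data (C, E, s): the realization s sends each element of [E C A] to an
    equivalence class of sequences A -> B -> C. So [real d s], for
    [d : E C A] and [s] a sequence, says that s(d) is the class of [s]. *)
Record extri_data (R : comPzRingType) := ExtriData {
  ecat :> lincat R;
  eext : bifun ecat ecat;
  real : forall C A : ecat, eext C A -> set (sequence A C);
  real_class : forall (C A : ecat) (d : eext C A),
    exists s, real d = [set t | seq_equiv s t] }.

Arguments eext {R} e.
Arguments real {R} e {C A} d.

Section Extriangulated.
Variables (R : comPzRingType) (T : extri_data R).
Local Notation E := (eext T).

(** The element of E(C (+) C', A (+) A') with components d, 0, 0, d'. *)
Definition ext_sum (C C' A A' : T) (SC : biproduct C C') (SA : biproduct A A')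
    (d : E C A) (d' : E C' A') : E SC SA :=
  push E (binj1 SA) (pull E (bpr1 SC) d) + push E (binj2 SA) (pull E (bpr2 SC) d').

Definition ET2_realization : Prop :=
  forall (C A C' A' : T) (d : E C A) (d' : E C' A') (a : mor A A') (c : mor C C')
    (s : sequence A C) (s' : sequence A' C'),
    real T d s -> real T d' s' -> push E a d = pull E c d' ->
    exists b : mor (mid s) (mid s'),
      b \@ sfst s = sfst s' \@ a /\ ssnd s' \@ b = c \@ ssnd s.

Definition ET2_zero : Prop :=
  forall (C A : T) (S : biproduct A C),
    real T (0 : E C A) (Sequence (binj1 S) (bpr2 S)).

Definition ET2_sum : Prop :=
  forall (C A C' A' : T) (d : E C A) (d' : E C' A')
    (s : sequence A C) (s' : sequence A' C')
    (SA : biproduct A A') (SB : biproduct (mid s) (mid s'))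
    (SC : biproduct C C'),
    real T d s -> real T d' s' ->
    real T (ext_sum SC SA d d')
      (Sequence (bsum SA SB (sfst s) (sfst s')) (bsum SB SC (ssnd s) (ssnd s'))).

Definition ET3 : Prop :=
  forall (C A C' A' : T) (d : E C A) (d' : E C' A')
    (s : sequence A C) (s' : sequence A' C')
    (a : mor A A') (b : mor (mid s) (mid s')),
    real T d s -> real T d' s' -> b \@ sfst s = sfst s' \@ a ->
    exists c : mor C C',
      c \@ ssnd s = ssnd s' \@ b /\ push E a d = pull E c d'.

Definition ET3op : Prop :=
  forall (C A C' A' : T) (d : E C A) (d' : E C' A')
    (s : sequence A C) (s' : sequence A' C')
    (b : mor (mid s) (mid s')) (c : mor C C'),
    real T d s -> real T d' s' -> c \@ ssnd s = ssnd s' \@ b ->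
    exists a : mor A A',
      b \@ sfst s = sfst s' \@ a /\ push E a d = pull E c d'.

Definition ET4 : Prop :=
  forall (A B C D F : T) (d : E D A) (d' : E F B)
    (f : mor A B) (f' : mor B D) (g : mor B C) (g' : mor C F),
    real T d (Sequence f f') -> real T d' (Sequence g g') ->
    exists (X : T) (u : mor D X) (e : mor X F) (h' : mor C X) (d'' : E X A),
      [/\ real T d'' (Sequence (g \@ f) h'),
          h' \@ g = u \@ f' /\ e \@ h' = g',
          real T (push E f' d') (Sequence u e),
          pull E u d'' = d &
          push E f d'' = pull E e d'].

(** The statement of [ET4] in the opposite category. *)
Definition ET4op : Prop :=
  forall (A B C D F : T) (d : E A D) (d' : E B F)
    (f : mor B A) (f' : mor D B) (g : mor C B) (g' : mor F C),
    real T d (Sequence f' f) -> real T d' (Sequence g' g) ->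
    exists (X : T) (u : mor X D) (e : mor F X) (h' : mor X C) (d'' : E A X),
      [/\ real T d'' (Sequence h' (f \@ g)),
          g \@ h' = f' \@ u /\ h' \@ e = g',
          real T (pull E f' d') (Sequence e u),
          push E u d'' = d &
          pull E f d'' = push E e d'].

Record extriangulated : Prop := Extriangulated {
  ext_additive : additive_cat T;
  ext_realization : ET2_realization;
  ext_zero : ET2_zero;
  ext_add : ET2_sum;
  ext_ET3 : ET3;
  ext_ET3op : ET3op;
  ext_ET4 : ET4;
  ext_ET4op : ET4op }.

Definition Ext_finite : Prop := forall C A : T, finitely_generated (E C A).

Definition projective : set T := [set P | forall (A : T) (d : E P A), d = 0].
Definition injective_obj : set T := [set I | forall (C : T) (d : E C I), d = 0].

Definition enough_projectives : Prop :=
  forall C : T, exists (A : T) (d : E C A) (s : sequence A C),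
    real T d s /\ projective (mid s).

Definition enough_injectives : Prop :=
  forall A : T, exists (C : T) (d : E C A) (s : sequence A C),
    real T d s /\ injective_obj (mid s).

Definition proj_morphisms (A B : T) : submodule (mor A B).
Proof.
refine (@Submodule R (mor A B)
  (fun f => forall (X : T) (d : E B X), pull E f d = 0) _ _).
- by move=> X d; apply: pull0m.
- by move=> a f g Pf Pg X d; rewrite pull_linm Pf Pg scaler0 addr0.
Defined.

Definition inj_morphisms (A B : T) : submodule (mor A B).
Proof.
refine (@Submodule R (mor A B)
  (fun f => forall (X : T) (d : E X A), push E f d = 0) _ _).
- by move=> X d; apply: push0m.
- by move=> a f g Pf Pg X d; rewrite push_linm Pf Pg scaler0 addr0.
Defined.

Definition proj_ideal : ideal T.
Proof.
refine (@Ideal R T proj_morphisms _ _).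
- by move=> A B D g f Pf X d; rewrite pull_comp Pf.
- by move=> A B D g f Pg X d; rewrite pull_comp Pg pull0.
Defined.

Definition inj_ideal : ideal T.
Proof.
refine (@Ideal R T inj_morphisms _ _).
- by move=> A B D g f Pf X d; rewrite push_comp Pf push0.
- by move=> A B D g f Pg X d; rewrite push_comp Pg.
Defined.

Definition stable : lincat R := quot_cat proj_ideal.
Definition costable : lincat R := quot_cat inj_ideal.

Definition stable_ext : bifun stable costable :=
  @quot_bifun R T T E proj_ideal inj_ideal
    (fun X X' Y c d Pc => Pc Y d) (fun X Y Y' a d Pa => Pa X d).

(** With enough projectives (resp. injectives) the two ideals consist of the
    morphisms factoring through a projective (resp. injective) object. *)
Lemma proj_idealE (TE : extriangulated) (TP : enough_projectives)
  (A B : T) (f : mor A B) :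
  proj_ideal A B f <-> factors_through projective f.
Proof.
split=> [Pf | [P [g [h [PP ->]]]] X d]; last first.
  by rewrite pull_comp [pull E h d]PP pull0.
have [X [d [s [sd Ps]]]] := TP B.
have [_ /(_ X A) [S]] := ext_additive TE.
have [|b [_ bE]] := ext_realization TE (a := idm X) (c := f) (ext_zero TE S) sd.
  by rewrite push0 Pf.
exists (mid s), (b \@ binj2 S), (ssnd s); split=> //.
by rewrite compA bE /= -compA bpr2_in2 compm1.
Qed.

Lemma inj_idealE (TE : extriangulated) (TI : enough_injectives)
  (A B : T) (f : mor A B) :
  inj_ideal A B f <-> factors_through injective_obj f.
Proof.
split=> [If | [P [g [h [PP ->]]]] X d]; last first.
  by rewrite push_comp [push E g d]PP push0.
have [X [d [s [sd Is]]]] := TI A.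
have [_ /(_ B X) [S]] := ext_additive TE.
have [|b [bE _]] := ext_realization TE (a := f) (c := idm X) sd (ext_zero TE S).
  by rewrite pull0 If.
exists (mid s), (sfst s), (bpr1 S \@ b); split=> //.
by rewrite -compA bE /= compA bpr1_in1 comp1m.
Qed.

(** Restriction of (C, E, s) to a family of submodules of E stable under
    [pull] and [push]. *)
Section Restriction.
Variable F : forall C A : T, submodule (E C A).
Hypothesis F_pull : forall (X X' Y : T) (c : mor X' X) (d : E X Y),
  F X Y d -> F X' Y (pull E c d).
Hypothesis F_push : forall (X Y Y' : T) (a : mor Y Y') (d : E X Y),
  F X Y d -> F X Y' (push E a d).

Definition sub_ext (C A : T) : lmodType R := subm (F C A).

Definition sub_pull (X X' Y : T) (c : mor X' X) (d : sub_ext X Y) :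
    sub_ext X' Y :=
  mk_subm (F_pull c (subm_mem d)).

Definition sub_push (X Y Y' : T) (a : mor Y Y') (d : sub_ext X Y) :
    sub_ext X Y' :=
  mk_subm (F_push a (subm_mem d)).

Definition sub_bifun : bifun T T.
Proof.
refine (@Bifun R T T sub_ext sub_pull sub_push _ _ _ _ _ _ _ _ _).
- by move=> X X' Y c a d d'; apply: val_inj; rewrite /= pull_lin.
- by move=> X Y Y' c a d d'; apply: val_inj; rewrite /= push_lin.
- by move=> X X' Y d a c c'; apply: val_inj; rewrite /= pull_linm.
- by move=> X Y Y' d a c c'; apply: val_inj; rewrite /= push_linm.
- by move=> X Y d; apply: val_inj; rewrite /= pull1.
- by move=> X Y d; apply: val_inj; rewrite /= push1.
- by move=> *; apply: val_inj; rewrite /= pull_comp.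
- by move=> *; apply: val_inj; rewrite /= push_comp.
- by move=> *; apply: val_inj; rewrite /= push_pull.
Defined.

Definition restriction : extri_data R :=
  @ExtriData R T sub_bifun (fun C A d => real T (subm_val d))
    (fun C A d => real_class (subm_val d)).

End Restriction.

Section Relative.
Variable D : set T.

(** E_D(C, A) *)
Definition ext_lower (C A : T) : submodule (E C A).
Proof.
refine (@Submodule R (E C A)
  (fun d => forall (X : T) (f : mor X C), D X -> pull E f d = 0) _ _).
- by move=> X f _; apply: pull0.
- by move=> a x y Hx Hy X f DX; rewrite pull_lin Hx // Hy // scaler0 addr0.
Defined.

(** E^D(C, A) *)
Definition ext_upper (C A : T) : submodule (E C A).
Proof.
refine (@Submodule R (E C A)
  (fun d => forall (X : T) (f : mor A X), D X -> push E f d = 0) _ _).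
- by move=> X f _; apply: push0.
- by move=> a x y Hx Hy X f DX; rewrite push_lin Hx // Hy // scaler0 addr0.
Defined.

Lemma ext_lower_pull (X X' Y : T) (c : mor X' X) (d : E X Y) :
  ext_lower X Y d -> ext_lower X' Y (pull E c d).
Proof. by move=> Hd Z f DZ; rewrite -pull_comp Hd. Qed.

Lemma ext_lower_push (X Y Y' : T) (a : mor Y Y') (d : E X Y) :
  ext_lower X Y d -> ext_lower X Y' (push E a d).
Proof. by move=> Hd Z f DZ; rewrite -push_pull Hd // push0. Qed.

Lemma ext_upper_pull (X X' Y : T) (c : mor X' X) (d : E X Y) :
  ext_upper X Y d -> ext_upper X' Y (pull E c d).
Proof. by move=> Hd Z f DZ; rewrite push_pull Hd // pull0. Qed.

Lemma ext_upper_push (X Y Y' : T) (a : mor Y Y') (d : E X Y) :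
  ext_upper X Y d -> ext_upper X Y' (push E a d).
Proof. by move=> Hd Z f DZ; rewrite -push_comp Hd. Qed.

Definition relative_lower : extri_data R :=
  restriction ext_lower_pull ext_lower_push.
Definition relative_upper : extri_data R :=
  restriction ext_upper_pull ext_upper_push.

End Relative.

End Extriangulated.

Arguments projective {R} T.
Arguments injective_obj {R} T.
Arguments relative_lower {R} T D.
Arguments relative_upper {R} T D.

(** The quotient of T by the ideal [D], for D a full subcategory of objects
    which are both projective and injective in T. The ideal is given as an
    [ideal] together with a proof that it is [D]. *)
Section IdealQuotient.
Variables (R : comPzRingType) (T : extri_data R) (D : set T) (I : ideal T).
Hypothesis D_proj : D `<=` projective T.
Hypothesis D_inj : D `<=` injective_obj T.
Hypothesis I_D : forall (A B : T) (f : mor A B),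
  I A B f <-> factors_through D f.

Lemma ideal_pull0 (X X' Y : T) (c : mor X' X) (d : eext T X Y) :
  I X' X c -> pull (eext T) c d = 0.
Proof.
move=> /I_D [P [g [h [DP ->]]]].
by rewrite pull_comp [pull _ h d](D_proj DP) pull0.
Qed.

Lemma ideal_push0 (X Y Y' : T) (a : mor Y Y') (d : eext T X Y) :
  I Y Y' a -> push (eext T) a d = 0.
Proof.
move=> /I_D [P [g [h [DP ->]]]].
by rewrite push_comp [push _ g d](D_inj DP) push0.
Qed.

Definition idquot_ext : bifun (quot_cat I) (quot_cat I) :=
  quot_bifun ideal_pull0 ideal_push0.

Definition idquot_real (C A : quot_cat I) (d : idquot_ext C A) :
    set (sequence A C) :=
  [set t | exists s : @sequence R T A C,
    real T d s /\ seq_equiv (map_sequence (quot_proj I) s) t].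

Lemma idquot_real_class (C A : quot_cat I) (d : idquot_ext C A) :
  exists s, idquot_real d = [set t | seq_equiv s t].
Proof.
have [s0 s0E] := @real_class R T C A d.
exists (map_sequence (quot_proj I) s0); apply/seteqP; split=> t /=.
  move=> [s [sd st]]; apply: seq_equiv_trans st.
  by apply: map_sequence_equiv; move: sd; rewrite s0E.
by move=> st; exists s0; split=> //; rewrite s0E /=; apply: seq_equiv_refl.
Qed.

Definition ideal_quotient : extri_data R := ExtriData idquot_real_class.

End IdealQuotient.

Definition exact_functor (R : comPzRingType) (T T' : extri_data R)
    (F : linfunctor T T')
    (phi : bifun_trans (eext T) (bifun_comp (eext T') F F)) : Prop :=
  forall (C A : T) (d : eext T C A) (s : sequence A C),
    real T d s -> real T' (phi C A d) (map_sequence F s).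

(** [ars_eta A B] is an isomorphism from the stable Hom-module to the J-dual
    of E(B, tau A); the last field is naturality in both A and B. *)
Record right_ARS_duality (R : comPzRingType) (J : lmodType R)
    (T : extri_data R) := RightARSDuality {
  ars_tau : linfunctor (stable T) (costable T);
  ars_eta : forall A B : stable T,
    {linear mor A B -> homm (stable_ext T B (ars_tau A)) J};
  ars_eta_bij : forall A B : stable T, bijective (ars_eta A B);
  ars_eta_nat : forall (A A' B B' : stable T) (a : mor A' A) (b : mor B B')
    (f : mor A B) (d : stable_ext T B' (ars_tau A')),
    ars_eta A' B' (b \@ f \@ a) d =
    ars_eta A B f
      (push (stable_ext T) (fmap ars_tau a) (pull (stable_ext T) b d)) }.

Section RelativeQuotients.
Variables (R : comPzRingType) (T : extri_data R).
Hypothesis TE : extriangulated T.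

Lemma upper_projective :
  projective T `<=` projective (relative_upper T (projective T)).
Proof. by move=> P PP A d; apply: val_inj; apply: PP. Qed.

Lemma upper_injective :
  projective T `<=` injective_obj (relative_upper T (projective T)).
Proof.
move=> P PP A d; apply: val_inj; rewrite /= -[LHS]push1.
exact: (subm_mem d).
Qed.

Lemma lower_injective :
  injective_obj T `<=` injective_obj (relative_lower T (injective_obj T)).
Proof. by move=> P PP A d; apply: val_inj; apply: PP. Qed.

Lemma lower_projective :
  injective_obj T `<=` projective (relative_lower T (injective_obj T)).
Proof.
move=> P PP A d; apply: val_inj; rewrite /= -[LHS]pull1.
exact: (subm_mem d).
Qed.

(** The quotient of the relative theory of E^Q by Q, Q the projectives. *)
Definition stable_extri (TP : enough_projectives T) : extri_data R :=
  @ideal_quotient R (relative_upper T (projective T)) (projective T)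
    (proj_ideal T) upper_projective upper_injective (proj_idealE TE TP).

(** The quotient of the relative theory of E_J by J, J the injectives. *)
Definition costable_extri (TI : enough_injectives T) : extri_data R :=
  @ideal_quotient R (relative_lower T (injective_obj T)) (injective_obj T)
    (inj_ideal T) lower_projective lower_injective (inj_idealE TE TI).

End RelativeQuotients.

(* Main.v *)
Require Import Defs.
From HB Require Import structures.
From mathcomp Require Import all_boot all_algebra.
From mathcomp Require Import boolp classical_sets.
(* Again, so that compA is not the associativity of function composition. *)
Require Import Defs.

Set Implicit Arguments.
Unset Strict Implicit.
Unset Printing Implicit Defensive.

Import GRing.Theory.
Local Open Scope ring_scope.

(** Let theta_C : E(C, tau C) -> J be the functional which the duality attaches
    to the identity of C. The pairing theta_A (f^* d) between f : A -> B and d in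
    E(B, tau A) is perfect by hypothesis and Matlis duality; testing naturality
    on an embedding of X into an injective object shows that
    theta_C (c_* e), for c : X -> tau C and e in E(C, X), is perfect too.
    Hence d in E^Q(C, A) and phi(d) in E_J(tau C, tau A) determine each other by
    theta_A (f^* phi(d)) = theta_C (f_* d) for all f : A -> tau C. If A -> B -> C
    realizes d and tau A -> M -> tau C realizes phi(d), a comparison morphism
    M -> tau B is a functional on E(B, M) with prescribed values on the images of
    E(B, tau A) and E(C, M); these values agree by a connecting morphism argument
    and the functional exists because J is injective. A five lemma for the
    functors E(X, -) makes the comparison an isomorphism modulo injectives. *)

(** * Modules over an artinian ring *)

Section LinearMaps.
Variables (R : comPzRingType) (U V : lmodType R) (f : U -> V) (f_lin : linear f).

Definition lin_of : {linear U -> V} :=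
  HB.pack f (GRing.isLinear.Build R U V _ f f_lin).

Lemma lin_ofE x : lin_of x = f x.
Proof. by []. Qed.

End LinearMaps.

(** * Submodules and chain conditions *)

Section SubmoduleLattice.
Variables (R : comPzRingType) (V : lmodType R).
Implicit Types (N K : submodule V) (b : bool).

Definition subsub N K := forall x, N x -> K x.

Lemma submodule_ext N K : subsub N K -> subsub K N -> N = K.
Proof.
case: N K => [N N0 Nl] [K K0 Kl] NK KN.
have E : N = K by apply: funext => x; apply: propext; split; [apply: NK|apply: KN].
subst K; congr Submodule; exact: Prop_irrelevance.
Qed.

Lemma smemN N x : N x -> N (- x).
Proof. by move=> Nx; rewrite -scaleN1r; apply: smemZ. Qed.

Lemma smemB N x y : N x -> N y -> N (x - y).
Proof. by move=> Nx Ny; apply/smemD/smemN. Qed.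

Definition sub_zero : submodule V.
Proof.
refine (@Submodule R V (fun x => x = 0) _ _) => //.
by move=> a x y -> ->; rewrite scaler0 addr0.
Defined.

Definition sub_top : submodule V.
Proof. by refine (@Submodule R V (fun x => True) _ _). Defined.

Definition sub_cap N K : submodule V.
Proof.
refine (@Submodule R V (fun x => N x /\ K x) _ _).
- by split; apply: smem0.
- by move=> a x y [Nx Kx] [Ny Ky]; split; apply: smem_lin.
Defined.

Definition adjoin (v : V) N : submodule V.
Proof.
refine (@Submodule R V (fun x => exists r : R, N (x - r *: v)) _ _).
- by exists 0; rewrite scale0r subr0; apply: smem0.
- move=> a x y [r Nr] [t Nt]; exists (a * r + t).
  have -> : a *: x + y - (a * r + t) *: v = a *: (x - r *: v) + (y - t *: v).
    by rewrite scalerBr scalerA addrACA -opprD -scalerDl.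
  exact: smem_lin.
Defined.

Lemma adjoin_sub v N : subsub N (adjoin v N).
Proof. by move=> x Nx; exists 0; rewrite scale0r subr0. Qed.

Lemma adjoin_mem v N : adjoin v N v.
Proof. by exists 1; rewrite scale1r subrr; apply: smem0. Qed.

Definition span (s : seq V) : submodule V := foldr adjoin sub_zero s.

Lemma span_coef (s : seq V) x : span s x ->
  exists c : 'I_(size s) -> R, x = \sum_(i < size s) c i *: s`_i.
Proof.
elim: s x => [x -> |v s IH x [r /IH [c xE]]] /=.
  by exists (fun=> 0); rewrite big_ord0.
exists (fun i => if unlift ord0 i is Some j then c j else r).
rewrite big_ord_recl unlift_none /= -[LHS](subrK (r *: v)) xE addrC; congr (_ + _).
by apply: eq_bigr => i _; rewrite liftK.
Qed.

Lemma span_mem (s : seq V) x : x \in s -> span s x.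
Proof.
elim: s => //= v s IH; rewrite inE => /orP[/eqP ->|/IH]; first exact: adjoin_mem.
exact: adjoin_sub.
Qed.

Lemma smem_sum N n (c : 'I_n -> R) (v : 'I_n -> V) :
  (forall i, N (v i)) -> N (\sum_(i < n) c i *: v i).
Proof.
move=> Nv; elim/big_ind: _ => [|x y|i _]; [exact: smem0|exact: smemD|exact: smemZ].
Qed.

Lemma fg_span : finitely_generated V -> exists s, forall x, span s x.
Proof.
move=> [n [v Hv]]; exists [seq v i | i <- enum 'I_n] => x.
have [c ->] := Hv x; apply: smem_sum => i; apply: span_mem.
by apply: map_f; rewrite mem_enum.
Qed.

Definition sub_le b N K := if b then subsub N K else subsub K N.

(** Chain condition on the submodules of [K]: descending for [b = true],
    ascending for [b = false]. *)
Definition chain_cond b K := forall P : submodule V -> Prop,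
  (exists N, P N) -> (forall N, P N -> subsub N K) ->
  exists N, P N /\ forall N', P N' -> sub_le b N' N -> N' = N.

Lemma sub_le_eq b N K : sub_le b N K -> sub_le b K N -> N = K.
Proof. by case: b => /= NK KN; apply: submodule_ext. Qed.

Lemma chain_cond_zero b : chain_cond b sub_zero.
Proof.
move=> P [N PN] PK; exists N; split=> // N' PN' _.
by apply: submodule_ext => x /PK-/(_ _)->//; apply: smem0.
Qed.

End SubmoduleLattice.

Arguments sub_top {R V}.

Section Trace.
Variables (R : comPzRingType) (V : lmodType R).
Implicit Types (N K : submodule V) (b : bool).

(** The ideal of those [r] with [r *: v] in [N + K]; it measures the image of [N] modulo [K]. *)
Definition trace (v : V) K N : submodule (R^o : lmodType R).
Proof.
refine (@Submodule R (R^o : lmodType R)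
  (fun r => exists y, K y /\ N ((r : R) *: v + y)) _ _).
- by exists 0; rewrite scale0r addr0; split; apply: smem0.
- move=> a r t [y [Ky Ny]] [z [Kz Nz]]; exists (a *: y + z).
  split; first exact: smem_lin.
  rewrite scalerDl -scalerA addrACA -scalerDr; exact: smem_lin.
Defined.

Lemma trace_le b v K N N' : sub_le b N N' -> sub_le b (trace v K N) (trace v K N').
Proof. by case: b => /= NN r [y [Ky Ny]]; exists y; split=> //; apply: NN. Qed.

Lemma cap_le b K N N' : sub_le b N N' -> sub_le b (sub_cap N K) (sub_cap N' K).
Proof. by case: b => /= NN r [y Ky]; split=> //; apply: NN. Qed.

(** Equal traces give an element of [N'] congruent to [x] modulo [K]; the difference lies in both
    [N] and [K], hence in [N']. *)
Lemma trace_modular v K N N' : subsub N (adjoin v K) -> subsub N' N ->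
  trace v K N = trace v K N' -> sub_cap N K = sub_cap N' K -> subsub N N'.
Proof.
move=> NK N'N Et Ec x Nx; have [r Kr] := NK x Nx.
have : trace v K N r by exists (x - r *: v); split=> //; rewrite addrC subrK.
rewrite Et => -[y [Ky Ny]].
have : sub_cap N K (x - (r *: v + y)).
  split; first by apply: smemB => //; apply: N'N.
  by rewrite opprD addrA; apply: smemB.
by rewrite Ec => -[N'd _]; rewrite -[x](subrK (r *: v + y)); apply: smemD.
Qed.

End Trace.

(** Make the trace extremal first, then the intersection with [K] among the members of [P] with that
    trace. A comparable member has the same two invariants, so [trace_modular] applies. *)
Lemma chain_cond_adjoin (R : comPzRingType) (V : lmodType R) b (v : V) K :
  chain_cond b (@sub_top R (R^o : lmodType R)) -> chain_cond b K ->
  chain_cond b (adjoin v K).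
Proof.
move=> cR cK P [N0 PN0] PK.
have [||A [[N1 [PN1 EA]] Amin]] := cR (fun A => exists N, P N /\ trace v K N = A).
- by exists (trace v K N0), N0.
- by [].
have [||B [[N [PN tN EB]] Bmin]] :=
  cK (fun B => exists N, [/\ P N, trace v K N = A & sub_cap N K = B]).
- by exists (sub_cap N1 K), N1.
- by move=> B [N [_ _ <-]] x [].
exists N; split=> // N' PN' le_N'N.
have tN' : trace v K N' = A.
  by apply: Amin; [exists N'|rewrite -tN; apply: trace_le].
have cN' : sub_cap N' K = B.
  by apply: Bmin; [exists N'|rewrite -EB; apply: cap_le].
apply: sub_le_eq (le_N'N) _.
case: b le_N'N {cR cK Amin Bmin} => /= le.
  by apply: (trace_modular (PK _ PN) le); rewrite ?tN ?tN' ?EB ?cN'.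
by apply: (trace_modular (PK _ PN') le); rewrite ?tN ?tN' ?EB ?cN'.
Qed.

Lemma chain_cond_fg (R : comPzRingType) (V : lmodType R) b :
  chain_cond b (@sub_top R (R^o : lmodType R)) -> finitely_generated V ->
  chain_cond b (@sub_top R V).
Proof.
move=> cR /fg_span[s Hs].
have -> : sub_top = span s by apply: submodule_ext.
elim: s {Hs} => [|v s IH] /=; first exact: chain_cond_zero.
exact: chain_cond_adjoin.
Qed.

Lemma artinian_chain_cond (R : comPzRingType) :
  artinian R -> chain_cond true (@sub_top R (R^o : lmodType R)).
Proof.
move=> Rart P [N0 PN0] _; apply: contrapT => Hno.
have step (N : {N | P N}) : exists N' : {N | P N},
    subsub (sval N') (sval N) /\ ~ subsub (sval N) (sval N').
  case: N => N PN /=; apply: contrapT => Hn; apply: Hno; exists N; split=> //.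
  move=> N' PN' le; apply: submodule_ext => //.
  by apply: contrapT => nle; apply: Hn; exists (exist _ N' PN').
have [nxt Hnxt] := choice step.
pose I n := iter n nxt (exist _ N0 PN0).
have [n x Inx|n Hn] := Rart (fun n => sval (I n)).
  by have [H _] := Hnxt (I n); apply: H.
have [_ H] := Hnxt (I n); apply: H => x; exact: (Hn n.+1 (leqnSn n) x).2.
Qed.

Definition limage (R : comPzRingType) (U V : lmodType R) (f : {linear U -> V}) :
  submodule V.
Proof.
refine (@Submodule R V (fun y => exists x, y = f x) _ _).
- by exists 0; rewrite linear0.
- by move=> a y z [u ->] [v ->]; exists (a *: u + v); rewrite linearP.
Defined.

Lemma fg_image (R : comPzRingType) (U V : lmodType R) (f : {linear U -> V}) :
  finitely_generated U -> (forall y, exists x, y = f x) -> finitely_generated V.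
Proof.
move=> [n [v Hv]] fS; exists n, (fun i => f (v i)) => y.
have [x ->] := fS y; have [c ->] := Hv x; exists c.
by rewrite linear_sum; apply: eq_bigr => i _; rewrite linearZ.
Qed.

Lemma fg_regular (R : comPzRingType) : finitely_generated (R^o : lmodType R).
Proof.
exists 1%N, (fun=> 1) => x; exists (fun=> x).
by rewrite big_ord_recl big_ord0 addr0 /GRing.scale /= mulr1.
Qed.

(** * Consequences of the ascending chain condition *)

Section Noetherian.
Variables (R : comPzRingType).
Hypothesis R_acc : chain_cond false (@sub_top R (R^o : lmodType R)).

(** A maximal one among the spans of finite lists from [N] is not enlarged by adjoining a further
    element of [N], so it is all of [N]. *)
Lemma fg_sub (V : lmodType R) (N : submodule V) :
  finitely_generated V -> finitely_generated (subm N : lmodType R).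
Proof.
move=> V_fg.
have [||K [[s [sN sK]] Kmax]] := chain_cond_fg R_acc V_fg
  (P := fun K => exists s : seq V, (forall x, x \in s -> N x) /\ span s = K).
- by exists (span [::]), [::].
- by [].
have NK x : N x -> K x.
  move=> Nx; have <- : span (x :: s) = K.
    apply: Kmax; last by rewrite -sK /=; apply: adjoin_sub.
    exists (x :: s); split=> // z; rewrite inE => /orP[/eqP ->|] //.
    exact: sN.
  by apply: span_mem; rewrite inE eqxx.
have s_in i : N s`_i.
  case: (ltnP i (size s)) => Hi; first exact/sN/mem_nth.
  by rewrite nth_default //; apply: smem0.
exists (size s), (fun i => mk_subm (s_in i)) => x.
have := NK _ (subm_mem x); rewrite -sK => /span_coef[c xE].
by exists c; apply: val_inj; rewrite (linear_sum (val : {linear subm N -> V})) /= xE.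
Qed.

(** Maximality in the form that [R / m] is a field. *)
Definition maximal_ideal (m : submodule (R^o : lmodType R)) : Prop :=
  ~ m (1 : R) /\ forall a : R, ~ m a -> exists r : R, m (1 - r * a).

Lemma maximal_ideal_exists (I : submodule (R^o : lmodType R)) :
  ~ I (1 : R) -> exists m, maximal_ideal m /\ subsub I m.
Proof.
move=> I1.
have [||m [[Im m1] mmax]] := R_acc (P := fun m => subsub I m /\ ~ m (1 : R)).
- by exists I; split.
- by [].
exists m; split=> //; split=> // a ma; apply: contrapT => Hno; apply: ma.
have <- : adjoin (a : R^o) m = m; last exact: adjoin_mem.
apply: mmax => /=; last exact: adjoin_sub.
split; first by move=> x /Im; apply: adjoin_sub.
by case=> r mr; apply: Hno; exists r.
Qed.

Lemma maximal_ideal_mem (m : submodule (R^o : lmodType R)) (V : lmodType R)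
    (N : submodule V) (y : V) (a : R) : maximal_ideal m ->
  (forall b : R, m b -> b *: y = 0) -> N (a *: y) -> ~ N y -> m a.
Proof.
move=> [_ mM] my Nay Ny; apply: contrapT => /mM[r mr]; apply: Ny.
have -> : y = r *: (a *: y); last exact: smemZ.
by have /eqP := my _ mr; rewrite scalerBl scale1r -scalerA subr_eq0 => /eqP.
Qed.

End Noetherian.

(** * Matlis duality *)

Section Matlis.
Variables (R : comPzRingType) (R_artin : artinian R) (J : lmodType R).
Hypothesis J_min : minimal_injective_cogenerator J.

Let J_inj : injective_in_mod J. Proof. by case: J_min. Qed.
Let J_cog : cogenerator_of_mod J. Proof. by case: J_min. Qed.
Let J_fg : finitely_generated J. Proof. by case: J_inj. Qed.

Lemma separation (M : lmodType R) (x : M) : finitely_generated M ->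
  (forall g : {linear M -> J}, g x = 0) -> x = 0.
Proof.
move=> M_fg Hx; apply: contrapT => x0.
have f_lin : linear (fun r : (R^o : lmodType R) => (r : R) *: x).
  by move=> a r t; rewrite scalerDl -scalerA.
have [|g [r]] := J_cog.2 _ _ (lin_of f_lin) (fg_regular R) M_fg.
  by exists 1; rewrite lin_ofE scale1r.
by rewrite lin_ofE linearZ_LR Hx scaler0.
Qed.

Lemma separation_mod (M : lmodType R) (N : submodule M) (x : M) :
  finitely_generated M ->
  (forall g : {linear M -> J}, (forall y, N y -> g y = 0) -> g x = 0) -> N x.
Proof.
move=> M_fg Hx.
have Q_fg : finitely_generated (quotm N : lmodType R).
  by apply: (fg_image (f := cl N)) M_fg _ => y; exists (rep y); exact/esym/repK.
rewrite -[x]subr0; apply/cl_eqP; rewrite cl0; apply: separation => // g.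
apply: (Hx (g \o cl N : {linear M -> J})) => y Ny /=.
have -> : cl N y = 0 by rewrite -(cl0 N); apply/cl_eqP; rewrite subr0.
exact: linear0.
Qed.

(** Evaluation at 1 identifies Hom(R/I, J) with this submodule. *)
Definition annihilated (I : submodule (R^o : lmodType R)) : submodule J.
Proof.
refine (@Submodule R J (fun u => forall a : R, I a -> a *: u = 0) _ _).
- by move=> a _; rewrite scaler0.
- move=> r u v Hu Hv a Ia.
  by rewrite scalerDr scalerA mulrC -scalerA Hu // Hv // scaler0 addr0.
Defined.

Let R_dcc := artinian_chain_cond R_artin.

(** Faithfulness of the cogenerator recovers an ideal [I] from [annihilated I],
    so the descending chain condition on [J] gives the ascending one on [R]. *)
Lemma noetherian : chain_cond false (@sub_top R (R^o : lmodType R)).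
Proof.
move=> P [I0 PI0] _.
have [||A [[I [PI EA]] Amin]] := chain_cond_fg R_dcc J_fg
  (P := fun A => exists I, P I /\ annihilated I = A).
- by exists (annihilated I0), I0.
- by [].
exists I; split=> // I' PI' /= II'; apply: submodule_ext => // x I'x.
apply: separation_mod (fg_regular R) _ => g gI.
have gE (r : R) : g r = r *: g (1 : R) by rewrite -linearZ /= /GRing.scale /= mulr1.
have : annihilated I (g (1 : R)) by move=> a Ia; rewrite -gE gI.
rewrite EA -(Amin (annihilated I')) => [/(_ x I'x)||].
- by rewrite -gE.
- by exists I'.
- by rewrite -EA => u Hu a Ia; apply/Hu/II'.
Qed.

(** [h] factors through the image of [f], which is finitely generated because [R] is noetherian,
    even if [U] is large; injectivity of [J] extends the factor to [V]. *)
Lemma extension (U V : lmodType R) (f : {linear U -> V}) (h : {linear U -> J}) :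
  finitely_generated V -> (forall u, f u = 0 -> h u = 0) ->
  exists g : {linear V -> J}, forall u, g (f u) = h u.
Proof.
move=> V_fg fh.
pose N := limage f.
have [c cE] := choice (fun w : subm N => subm_mem w).
have h_lin : linear (fun w => h (c w)).
  move=> a x y; apply/eqP; rewrite -linearP -subr_eq0 -linearB; apply/eqP/fh.
  by rewrite linearB linearP -!cE /= subrr.
have [g gE] := J_inj.2 _ _ (val : {linear subm N -> V}) (lin_of h_lin)
  (fg_sub noetherian N V_fg) V_fg val_inj.
exists g => u.
have Nfu : N (f u) by exists u.
rewrite -[f u]/(val (mk_subm Nfu)) gE lin_ofE; apply/eqP.
by rewrite -subr_eq0 -linearB; apply/eqP/fh; rewrite linearB -cE /= subrr.
Qed.

Section Socle.
Variables (m : submodule (R^o : lmodType R)) (x y : J).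
Hypotheses (mM : maximal_ideal m) (x0 : x <> 0) (y0 : y <> 0).
Hypotheses (mx : forall a : R, m a -> a *: x = 0).
Hypotheses (my : forall a : R, m a -> a *: y = 0).

(** If the socle of [J] had two independent copies [R x] and [R y] of the same
    simple module, then a submodule [N] maximal among those containing [x] but
    not [y] would be a direct summand of [J] and still a cogenerator. *)
Lemma socle_multiplicity_free : exists r : R, x = r *: y.
Proof.
apply: contrapT => Hno.
have J_acc := chain_cond_fg noetherian J_fg.
have [||N [[Nx Ny] Nmax]] := J_acc (fun N => N x /\ ~ N y).
- exists (adjoin x (@sub_zero R J)); split; first exact: adjoin_mem.
  move=> [r /= /subr0_eq yE]; apply: y0; rewrite yE.
  suff /mx : m r by [].
  apply: contrapT => /mM.2[t mt]; apply: Hno; exists t; rewrite yE scalerA.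
  by apply/eqP; rewrite -subr_eq0 -{1}[x]scale1r -scalerBl mx.
- by [].
(* By maximality every nonzero submodule of [J / N] contains the class of [y]. *)
have Nadj z : ~ N z -> exists r : R, N (y - r *: z).
  move=> Nz; apply: contrapT => Hadj; apply: Nz.
  have <- : adjoin z N = N; last exact: adjoin_mem.
  by apply: Nmax; [split => //; apply: adjoin_sub|apply: adjoin_sub].
have f_lin : linear (fun u : (subm N * (R^o : lmodType R))%type =>
    val u.1 + (u.2 : R) *: y).
  by move=> a u v /=; rewrite scalerDl -scalerA scalerDr addrACA.
have h_lin : linear (fun u : (subm N * (R^o : lmodType R))%type => (u.2 : R) *: y).
  by move=> a u v /=; rewrite scalerDl -scalerA.
(* [N] meets the simple module [R y] in 0, so some endomorphism [q] of [J] kills [N] and fixes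
   [y]. *)
have [|q qE] := extension (f := lin_of f_lin) (h := lin_of h_lin) J_fg.
  move=> u; rewrite !lin_ofE => /eqP; rewrite addrC addr_eq0 => /eqP yE.
  apply: my; apply: (maximal_ideal_mem mM my _ Ny).
  by rewrite yE; apply/smemN/subm_mem.
have qN z : N z -> q z = 0.
  move=> Nz; have := qE (mk_subm Nz, 0).
  by rewrite !lin_ofE /= scale0r addr0.
have qy : q y = y by have := qE (0, 1); rewrite !lin_ofE /= scale1r add0r.
have Nq z : N (q z) -> N z.
  move=> Nqz; apply: contrapT => /Nadj[r Nr]; apply: Ny.
  have := qN _ Nr; rewrite linearB linearZ_LR qy /= => /subr0_eq ->.
  exact: smemZ.
have NqK k z : N (iter k q z) -> N z by elim: k => //= k IH /Nq.
have iterB k z w : iter k q (z - w) = iter k q z - iter k q w.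
  by elim: k => //= k ->; rewrite linearB.
have [k Hk] : exists k, forall z, exists w, iter k q z = iter k.+1 q w.
  have im0 k : exists w, 0 = iter k q w.
    by exists 0; elim: k => //= k <-; rewrite linear0.
  have imL k a u v : (exists w, u = iter k q w) -> (exists w, v = iter k q w) ->
      exists w, a *: u + v = iter k q w.
    move=> [w ->] [w' ->]; exists (a *: w + w').
    by elim: k => //= k <-; rewrite linearP.
  have [||W [[k EW] Wmin]] := chain_cond_fg R_dcc J_fg
    (P := fun W => exists k, W = Submodule (im0 k) (imL k)).
  - by exists (Submodule (im0 0%N) (imL 0%N)), 0%N.
  - by [].
  exists k => z; have : W (iter k q z) by rewrite EW; exists z.
  rewrite -(Wmin (Submodule (im0 k.+1) (imL k.+1))) //; first by exists k.+1.
  by rewrite EW => u [w ->]; exists (q w); rewrite -iterSr.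
(* The images of the powers of [q] stabilize, and the preimage of [N] under each is contained in
   [N]. So [J] is the direct sum of [N] and the image of [q], and [z - q (c z)] is the projection to
   [N]. *)
have Hdec z : exists w, N (z - q w).
  have [w Hw] := Hk z; exists w; apply: (NqK k); rewrite iterB Hw iterSr subrr.
  exact: smem0.
have [c Hc] := choice Hdec.
have pr_uniq z w : N (z - q w) -> q w = q (c z).
  move=> Nw; apply/eqP; rewrite -subr_eq0 -linearB; apply/eqP/qN/Nq.
  rewrite linearB.
  have -> : q w - q (c z) = (z - q (c z)) - (z - q w).
    by rewrite opprB [RHS]addrC addrA subrK.
  exact: smemB.
have pr_lin : linear (fun z => mk_subm (Hc z) : subm N).
  move=> a u v; apply: val_inj => /=.
  have <- : q (a *: c u + c v) = q (c (a *: u + v)).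
    apply: pr_uniq; rewrite linearP opprD addrACA -scalerBr; exact: smem_lin.
  by rewrite linearP opprD addrACA scalerBr.
have prN z : N z -> lin_of pr_lin z = z :> J.
  move=> Nz /=; rewrite -(pr_uniq z 0) linear0 subr0 //; exact: Nz.
case: J_min => _ _ /(_ N) Jm; apply/Ny/Jm; split.
- exact: (fg_sub noetherian N J_fg).
- move=> M M' i f M_fg M'_fg i_inj.
  have [g gE] := J_inj.2 _ _ i (val \o f : {linear M -> J}) M_fg M'_fg i_inj.
  exists (lin_of pr_lin \o g : {linear M' -> subm N}) => u.
  by apply: val_inj; rewrite /= gE -[RHS](prN (val (f u))) //; apply: subm_mem.
- exact: (fg_sub noetherian N J_fg).
move=> M M' f M_fg M'_fg [z0]; set z := f z0 => z_neq0.
have ann0 : (0 : R) *: z = 0 by rewrite scale0r.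
have annL a (r t : R) : r *: z = 0 -> t *: z = 0 -> (a * r + t) *: z = 0.
  by move=> rz tz; rewrite scalerDl -scalerA rz tz scaler0 addr0.
have [|m' [m'M m'z]] := maximal_ideal_exists noetherian
    (I := @Submodule R R^o (fun r : R => r *: z = 0) ann0 annL).
  by rewrite /= scale1r.
(* Some nonzero [g 1] in [J] is killed by [m']. If it is outside [N], then [y] is a multiple of it
   modulo [N], so [m'] is contained in [m] and [x] serves as [u]. *)
have [u [Nu u0 m'u]] : exists u, [/\ N u, u <> 0 & forall a : R, m' a -> a *: u = 0].
  have : exists2 g : {linear R^o -> J}, (forall a, m' a -> g a = 0) & g 1 <> 0.
    apply: contrapT => Hg; apply: m'M.1; apply: separation_mod (fg_regular R) _ => g g0.
    by apply: contrapT => g1; apply: Hg; exists g.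
  case=> g gm g1.
  have gE (a : R) : m' a -> a *: g (1 : R) = 0.
    by move=> /gm; rewrite -linearZ_LR /= /GRing.scale /= mulr1.
  have [Ng|/Nadj[r Nr]] := pselect (N (g (1 : R))); first by exists (g (1 : R)).
  exists x; split=> // a m'a; apply: mx.
  apply: (maximal_ideal_mem mM my _ Ny).
  have -> : a *: y = a *: (y - r *: g (1 : R)); last exact: smemZ.
  by rewrite scalerBr scalerA mulrC -scalerA gE // scaler0 subr0.
have z_lin : linear (fun r : (R^o : lmodType R) => (r : R) *: z).
  by move=> a r t; rewrite scalerDl -scalerA.
have u_lin : linear (fun r : (R^o : lmodType R) => (r : R) *: u).
  by move=> a r t; rewrite scalerDl -scalerA.
have [|g gE] := extension (f := lin_of z_lin) (h := lin_of u_lin) M'_fg.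
  by move=> r; rewrite !lin_ofE => rz; apply/m'u/m'z.
exists (lin_of pr_lin \o g : {linear M' -> subm N}), z0 => /(congr1 val) pr0.
have gz : g z = u by have := gE 1; rewrite !lin_ofE /= !scale1r.
by apply: u0; rewrite -(prN u Nu) -gz; apply: pr0.
Qed.

End Socle.

Lemma homm_addE (M : lmodType R) (f : homm M J) x y : f (x + y) = f x + f y.
Proof. exact: (linearD (f : {linear M -> J})). Qed.

Lemma homm_scaleE (M : lmodType R) (f : homm M J) a x : f (a *: x) = a *: f x.
Proof. exact: (linearZ_LR (f : {linear M -> J})). Qed.

(** The submodules [N] such that [xi] is an evaluation on the functionals killing
    [N] shrink to 0, one simple layer at a time; each layer corrects the
    evaluation by a scalar, since the socle of [J] is multiplicity free. *)
Lemma reflexive_fg (M : lmodType R) (xi : {linear homm M J -> J}) :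
  finitely_generated M -> exists v : M, forall f : homm M J, xi f = f v.
Proof.
move=> M_fg; apply: contrapT => Hno.
have M_acc := chain_cond_fg noetherian M_fg.
have M_dcc := chain_cond_fg R_dcc M_fg.
pose kills (N : submodule M) (f : homm M J) := forall v, N v -> f v = 0.
have [||N [PN Nmax]] := M_acc (fun N =>
    ~ exists v, forall f, kills N f -> xi f = f v).
- exists (@sub_zero R M) => -[v Hv]; apply: Hno; exists v => f; apply: Hv.
  by move=> _ ->; apply: linear0.
- by [].
(* A minimal submodule strictly above [N] makes the layer [(N + R a) / N] simple; its annihilator
   [m] is then maximal. *)
have [a [Na amin]] : exists a, ~ N a /\
    forall b, adjoin a N b -> ~ N b -> adjoin b N a.
  have [|//|N' [[NN' [a N'a Na]] N'min]] := M_dcc (fun N' =>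
      subsub N N' /\ exists2 a, N' a & ~ N a).
    exists sub_top; split=> //; apply: contrapT => HN; apply: PN; exists 0 => f fN.
    have -> : f = 0.
      by apply: hommP => v; apply: fN; apply: contrapT => Nv; apply: HN; exists v.
    by rewrite !linear0.
  exists a; split=> // b aNb Nb.
  have N'b : N' b.
    case: aNb => r Nr; rewrite -[b](subrK (r *: a)).
    by apply/smemD/smemZ => //; apply: NN'.
  have -> : adjoin b N = N' => //.
  apply: N'min => [|v [r Nr]].
    by split; [apply: adjoin_sub|exists b => //; apply: adjoin_mem].
  by rewrite -[v](subrK (r *: b)); apply/smemD/smemZ => //; apply: NN'.
have m0 : N ((0 : R) *: a) by rewrite scale0r; apply: smem0.
have mL (r s t : R) : N (s *: a) -> N (t *: a) -> N ((r * s + t) *: a).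
  by move=> Ns Nt; rewrite scalerDl -scalerA; apply: smem_lin.
pose m := @Submodule R R^o (fun r : R => N (r *: a)) m0 mL.
have mM : maximal_ideal m.
  split=> [|r mr]; first by rewrite /= scale1r.
  have [|t Nt] := amin (r *: a) _ mr; first by apply: smemZ; apply: adjoin_mem.
  by exists t; rewrite /= scalerBl scale1r -scalerA.
have [v vE] : exists v, forall f, kills (adjoin a N) f -> xi f = f v.
  apply: contrapT => PN'; apply: Na.
  by rewrite -(Nmax _ PN'); [apply: adjoin_mem|apply: adjoin_sub].
have kills_adj f : kills N f -> f a = 0 -> kills (adjoin a N) f.
  move=> fN fa w [r Nr]; rewrite -[w](subrK (r *: a)) homm_addE homm_scaleE fa.
  by rewrite scaler0 addr0; apply: fN.
have [[f0 f0N f0a]|Hf] := pselect (exists2 f, kills N f & f a <> 0); last first.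
  apply: PN; exists v => f fN; apply: vE; apply: kills_adj => //.
  by apply: contrapT => fa; apply: Hf; exists f.
have m_fa f (r : R) : kills N f -> m r -> r *: f a = 0.
  by move=> fN mr; rewrite -homm_scaleE; apply: fN.
(* On functionals killing [N], the error of evaluation at [v] scales with the value at [a]; a
   multiple of [a] will correct it. *)
pose xi' (f : homm M J) := xi f - f v.
have xi'P f g (r : R) : kills N f -> kills N g -> f a = r *: g a -> xi' f = r *: xi' g.
  move=> fN gN fg; have kfg : kills (adjoin a N) (f - r *: g).
    apply: kills_adj => [w Nw|]; rewrite /homm_fun /=.
      by rewrite [X in X - _](fN w Nw) [X in _ *: X](gN w Nw) scaler0 subr0.
    by apply/eqP; rewrite subr_eq0; apply/eqP.
  have : xi f - r *: xi g = f v - r *: g v by rewrite -linearZ_LR -linearB vE.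
  rewrite /xi' scalerBr => /(canRL (subrK _)) ->.
  by rewrite addrAC [f v - _]addrC addrK addrC.
have m_xi' : forall r : R, m r -> r *: xi' f0 = 0.
  move=> r mr; rewrite -(xi'P 0) //.
  - by rewrite /xi' linear0 sub0r oppr0.
  - by rewrite m_fa.
have [t xi'0] : exists t, xi' f0 = t *: f0 a.
  have [xi0|xi0] := pselect (xi' f0 = 0); first by exists 0; rewrite scale0r.
  exact: (socle_multiplicity_free mM xi0 f0a m_xi' (fun r => m_fa f0 r f0N)).
apply: PN; exists (v + t *: a) => f fN.
have [r fE] : exists r, f a = r *: f0 a.
  have [fa|fa] := pselect (f a = 0); first by exists 0; rewrite scale0r.
  exact: (socle_multiplicity_free mM fa f0a
    (fun r => m_fa f r fN) (fun r => m_fa f0 r f0N)).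
rewrite homm_addE homm_scaleE fE scalerA mulrC -scalerA -xi'0 -(xi'P f f0 r) //.
by rewrite /xi' addrC subrK.
Qed.

(** By [surj], [xi] descends to a functional on Hom(V, J), which is an evaluation. [W] will be a
    module of morphisms, for which no finiteness is assumed. *)
Lemma reflexive_pairing (V W : lmodType R) (B : W -> V -> J) :
  finitely_generated V -> (forall w, linear (B w)) ->
  (forall v, linear (B^~ v)) ->
  (forall g : {linear V -> J}, exists w, forall v, g v = B w v) ->
  forall xi : {linear W -> J}, (forall w, (forall v, B w v = 0) -> xi w = 0) ->
  exists v, forall w, xi w = B w v.
Proof.
move=> V_fg BV BW surj xi xi0.
have [c cE] := choice (fun g : homm V J => surj g).
have xi_eq w w' : (forall v, B w v = B w' v) -> xi w = xi w'.
  move=> E; apply/eqP; rewrite -subr_eq0 -linearB; apply/eqP/xi0 => v.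
  by rewrite (GRing.zmod_morphism_linear (BW v)) E subrr.
have xi_lin : linear (fun g => xi (c g)).
  move=> a g h; rewrite -linearP; apply: xi_eq => v.
  by rewrite -cE BW -!cE.
have [v vE] := reflexive_fg (lin_of xi_lin) V_fg; exists v => w.
rewrite -[RHS](vE (lin_of (BV w))) lin_ofE; apply: xi_eq => v'.
by rewrite -cE.
Qed.

End Matlis.

(** * Extriangulated categories *)

Local Open Scope classical_set_scope.

Section Exactness.
Variables (R : comPzRingType) (T : extri_data R) (TE : extriangulated T).
Local Notation E := (eext T).

Definition split_seq (X Y : T) (S : biproduct X Y) : sequence X Y :=
  Sequence (binj1 S) (bpr2 S).

Lemma biprod (X Y : T) : inhabited (biproduct X Y).
Proof. by have [_] := ext_additive TE. Qed.

(** * Exact sequences attached to a triangle *)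

Section Triangle.
Variables (C A : T) (d : E C A) (s : sequence A C) (ds : real T d s).
Local Notation x := (sfst s).
Local Notation y := (ssnd s).

Lemma tri_push0 : push E x d = 0.
Proof.
have [S] := biprod (mid s) C.
have [//=|c [_ ->]] :=
  ext_ET3 TE (a := x) (s' := split_seq S) (b := binj1 S) ds (ext_zero TE S).
exact: pull0.
Qed.

Lemma tri_pull0 : pull E y d = 0.
Proof.
have [S] := biprod A (mid s).
have [//=|a [_ <-]] :=
  ext_ET3op TE (s := split_seq S) (b := bpr2 S) (c := y) (ext_zero TE S) ds.
exact: push0.
Qed.

Lemma factor_sfst (X : T) (f : mor A X) :
  push E f d = 0 -> exists g : mor (mid s) X, g \@ x = f.
Proof.
move=> fd; have [S] := biprod X C.
have [|b [bx _]] := ext_realization TE (a := f) (c := idm C) ds (ext_zero TE S).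
  by rewrite fd pull0.
by exists (bpr1 S \@ b); rewrite -compA bx /= compA bpr1_in1 comp1m.
Qed.

Lemma factor_ssnd (X : T) (f : mor X C) :
  pull E f d = 0 -> exists g : mor X (mid s), y \@ g = f.
Proof.
move=> fd; have [S] := biprod A X.
have [|b [_ yb]] := ext_realization TE (a := idm A) (c := f) (ext_zero TE S) ds.
  by rewrite fd push0.
by exists (b \@ binj2 S); rewrite compA yb /= -compA bpr2_in2 compm1.
Qed.

Lemma weak_cokernel (X : T) (g : mor (mid s) X) :
  g \@ x = 0 -> exists h : mor C X, h \@ y = g.
Proof.
move=> gx; have [S] := biprod X X.
have [|c [cy _]] :=
  ext_ET3 TE (a := 0 : mor A X) (s' := split_seq S) (b := binj2 S \@ g)
    ds (ext_zero TE S).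
  by rewrite /= -compA gx !compm0.
by exists c; rewrite cy /= compA bpr2_in2 comp1m.
Qed.

(** Realize [e] by [t]. As x_* e = 0, [x] extends over the middle term of [t], and ET3 completes
    this to a morphism of triangles that is the identity on [A]. *)
Lemma ext_pull_ssnd0 (X : T) (e : E X A) :
  push E x e = 0 -> exists c : mor X C, pull E c d = e.
Proof.
move=> xe; have [t et] := real_class e.
have {}et : real T e t by rewrite et; apply: seq_equiv_refl.
have [S] := biprod (mid s) X.
have [|b [bx _]] := ext_realization TE (a := x) (c := idm X) et (ext_zero TE S).
  by rewrite xe pull0.
have [|c [_ cd]] := ext_ET3 TE (a := idm A) (b := bpr1 S \@ b) et ds.
  by rewrite -compA bx /= compA bpr1_in1 comp1m compm1.
by exists c; rewrite -cd push1.
Qed.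

Lemma ext_push_sfst0 (X : T) (e : E C X) :
  pull E y e = 0 -> exists a : mor A X, push E a d = e.
Proof.
move=> ye; have [t et] := real_class e.
have {}et : real T e t by rewrite et; apply: seq_equiv_refl.
have [S] := biprod X (mid s).
have [|b [_ yb]] := ext_realization TE (a := idm X) (c := y) (ext_zero TE S) et.
  by rewrite ye push0.
have [|c [_ cd]] := ext_ET3op TE (b := b \@ binj2 S) (c := idm C) ds et.
  by rewrite comp1m compA yb /= -compA bpr2_in2 compm1.
by exists c; rewrite cd pull1.
Qed.

End Triangle.

(** ET4 for [d] and [e] gives a triangle C -> K -> X whose class is 0; a section of K -> X pulls the
    new class in E(K, A) back to [e']. *)
Lemma ext_push_exact (C A : T) (d : E C A) (s : sequence A C) (X : T)
    (e : E X (mid s)) :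
  real T d s -> push E (ssnd s) e = 0 -> exists e' : E X A, push E (sfst s) e' = e.
Proof.
case: s e => [B f f'] /= e ds ye; have [t et] := real_class e.
have {et} : real T e t by rewrite et; apply: seq_equiv_refl.
case: t => [G g g'] et.
have [K [u [k [l [dd [_ _ re _ fd]]]]]] := ext_ET4 TE ds et.
have [|r /= kr] := factor_ssnd re (f := idm X); first by rewrite pull1.
by exists (pull E r dd); rewrite push_pull fd -pull_comp kr pull1.
Qed.

(** * Embeddings into injectives and the costable category *)

Section Injectives.
Hypothesis TI : enough_injectives T.

Lemma pull_of_hull (X Y W : T) (d : E Y X) (s : sequence X Y) (e : E W X) :
  real T d s -> injective_obj T (mid s) -> exists c : mor W Y, pull E c d = e.
Proof. by move=> ds sI; apply: (ext_pull_ssnd0 ds); apply: sI. Qed.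

(** ET4 applied to [s] followed by an embedding of its middle term into an
    injective object. *)
Lemma hull_octahedron (C A : T) (d : E C A) (s : sequence A C) :
  real T d s ->
  exists (I N K : T) (m : mor (mid s) I) (n : mor I N) (iota : E N (mid s))
    (u : mor C K) (k : mor K N) (l : mor I K) (kappa : E K A),
    [/\ injective_obj T I, real T iota (Sequence m n),
        real T kappa (Sequence (m \@ sfst s) l),
        real T (push E (ssnd s) iota) (Sequence u k) &
        [/\ pull E u kappa = d, push E (sfst s) kappa = pull E k iota,
            l \@ m = u \@ ssnd s & k \@ l = n]].
Proof.
case: s => [M p q] /= ds; have [N [iota [[I m n] [is_ sI]]]] := TI M.
have [K [u [k [l [kappa [rk [lm kl] ru pu pk]]]]]] := ext_ET4 TE ds is_.
by exists I, N, K, m, n, iota, u, k, l, kappa.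
Qed.

Lemma inj_ideal_pull_hull (W K A : T) (k : E K A) (s : sequence A K)
    (c : mor W K) :
  real T k s -> injective_obj T (mid s) -> pull E c k = 0 -> inj_ideal T W K c.
Proof.
move=> ks sI /(factor_ssnd ks)[g gE]; apply/inj_idealE => //.
by exists (mid s), g, (ssnd s).
Qed.

(** The two long exact sequences anticommute; in a triangulated category [f]
    would be the filler of a morphism of triangles. *)
Lemma connecting_morphism (C A C' A' : T) (d : E C A) (s : sequence A C)
    (d' : E C' A') (s' : sequence A' C') (u : E (mid s) A') (e : E C (mid s')) :
  real T d s -> real T d' s' ->
  push E (sfst s') u + pull E (ssnd s) e = 0 ->
  exists f : mor A C',
    pull E f d' = pull E (sfst s) u /\ push E f d = - push E (ssnd s') e.
Proof.
move=> ds ds' ue.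
have [I [N [K [m [n [iota [v [k [l [kappa [I_inj ri rk rv [vk pk lm kl]]]]]]]]]]]]
  := hull_octahedron ds'.
have [c cE] := pull_of_hull (s := Sequence m n) e ri I_inj.
have [w wE] := pull_of_hull (s := Sequence _ l) u rk I_inj.
(* By hypothesis the right side pulls [iota] back to 0. Correcting [w] by [l \@ t] then gives a
   commutative square over [- c], to which ET3op applies. *)
have [t tE] : exists t, n \@ t = k \@ w + c \@ ssnd s.
  apply: (factor_ssnd (s := Sequence m n) ri).
  rewrite -ue -wE -cE push_pull pk -!pull_comp.
  exact: (linearD (lin_of (pull_linm iota))).
have wc : - c \@ ssnd s = k \@ (w - l \@ t).
  rewrite compBr compA kl tE opprD addrA subrr sub0r.
  by rewrite -[- c]sub0r compBl comp0m sub0r.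
have [a /= [wx ad]] := ext_ET3op TE (s' := Sequence v k) ds rv wc.
have l0 : pull E l kappa = 0 by exact: (tri_pull0 (s := Sequence _ l) rk).
exists a; split.
  by rewrite -vk -pull_comp -wx pull_comp pullBm wE [pull E (l \@ t) _]pull_comp
    l0 pull0 subr0.
by rewrite ad -push_pull -[- c]sub0r pullBm pull0m sub0r cE -sub0r pushB push0 sub0r.
Qed.

(** Embed [N] into an injective, with class [d]. The preimage of [d] under [b] is a pushforward of
    [d] along some [b']; since every class in E(X, N) is a pullback of [d], [b'] inverts [b] on
    extensions. *)
Lemma costable_iso (M N : T) (b : mor M N) :
  (forall X (e : E X M), push E b e = 0 -> e = 0) ->
  (forall X (e : E X N), exists e', push E b e' = e) ->
  exists b' : mor N M,
    inj_ideal T M M (b' \@ b - idm M) /\ inj_ideal T N N (b \@ b' - idm N).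
Proof.
move=> b_inj b_surj; have [Y [d [s [ds sI]]]] := TI N.
have [e eE] := b_surj _ d.
have [|b' b'E] := ext_push_sfst0 ds (e := e).
  by apply: b_inj; rewrite push_pull eE (tri_pull0 ds).
have bb' X (z : E X N) : push E b (push E b' z) = z.
  by have [c <-] := pull_of_hull z ds sI; rewrite !push_pull b'E eE.
exists b'; split=> X z; rewrite pushBm push1 push_comp; last by rewrite bb' subrr.
by apply: b_inj; rewrite pushB bb' subrr.
Qed.

End Injectives.

Section Projectives.
Hypothesis TP : enough_projectives T.

Lemma upper_push0 (C A X : T) (d : E C A) (f : mor A X) :
  ext_upper (projective T) C A d -> proj_ideal T A X f -> push E f d = 0.
Proof.
move=> dU /(proj_idealE TE TP)[Q [g [h [PQ ->]]]].
by rewrite push_comp dU // push0.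
Qed.

(** The map from [A] to the projective extends along [sfst s] because [d] is in E^Q; subtracting the
    resulting map from [g] leaves one that vanishes on [sfst s]. *)
Lemma stable_weak_cokernel (C A X : T) (d : E C A) (s : sequence A C)
    (g : mor (mid s) X) :
  real T d s -> ext_upper (projective T) C A d ->
  proj_ideal T A X (g \@ sfst s) ->
  exists h : mor C X, proj_ideal T (mid s) X (g - h \@ ssnd s).
Proof.
move=> ds dU /(proj_idealE TE TP)[Q [j [r [PQ gx]]]].
have [j' j'E] := factor_sfst ds (dU _ j PQ).
have [|h hE] := weak_cokernel ds (g := g - r \@ j').
  by rewrite compBl gx -compA j'E subrr.
exists h; apply/proj_idealE => //; exists Q, j', r; split=> //.
by rewrite hE opprB addrC subrK.
Qed.

End Projectives.

End Exactness.

(** * Duality *)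

Section Duality.
Variables (R : comPzRingType) (R_artin : artinian R) (J : lmodType R).
Hypothesis J_min : minimal_injective_cogenerator J.
Variables (T : extri_data R) (TE : extriangulated T) (T_fin : Ext_finite T).
Hypotheses (TP : enough_projectives T) (TI : enough_injectives T).
Local Notation E := (eext T).

(** A right ARS duality lifted from the quotients to [T]: [tm] lifts the action
    of tau on morphisms and [theta C] is the functional on E(C, tau C) attached
    to the identity of [C]. *)
Variables (tau : T -> T) (tm : forall A B : T, mor A B -> mor (tau A) (tau B)).
Variable theta : forall C : T, {linear E C (tau C) -> J}.
Hypothesis theta_nat : forall (A B : T) (f : mor A B) (d : E B (tau A)),
  theta B (push E (tm f) d) = theta A (pull E f d).
Hypothesis theta_rep : forall (A B : T) (g : {linear E B (tau A) -> J}),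
  exists f : mor A B, forall d, g d = theta A (pull E f d).
Hypothesis theta_proj : forall (A B : T) (f : mor A B),
  (forall d : E B (tau A), theta A (pull E f d) = 0) -> proj_ideal T A B f.

Lemma theta_pull_sep (A B : T) (d : E B (tau A)) :
  (forall f : mor A B, theta A (pull E f d) = 0) -> d = 0.
Proof.
move=> Hd; apply: (separation J_min (T_fin _ _)) => g.
by have [f ->] := theta_rep g.
Qed.

Lemma tm_faithful (A B : T) (f : mor A B) :
  inj_ideal T _ _ (tm f) -> proj_ideal T A B f.
Proof.
by move=> tf; apply: theta_proj => d; rewrite -theta_nat tf linear0.
Qed.

(** [f] represents the functional theta_B (h_* d) of [d] in E(B, tau A). *)
Lemma tm_full (A B : T) (h : mor (tau A) (tau B)) :
  exists f : mor A B, inj_ideal T _ _ (h - tm f).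
Proof.
have [f fE] := theta_rep (theta B \o lin_of (@push_lin _ _ _ E B _ _ h)).
exists f => X d; apply: theta_pull_sep => g.
rewrite -push_pull pushBm linearB theta_nat.
by rewrite -fE subrr.
Qed.

Lemma theta_pull_reflexive (A B : T) (xi : {linear mor A B -> J}) :
  (forall f, proj_ideal T A B f -> xi f = 0) ->
  exists d : E B (tau A), forall f, xi f = theta A (pull E f d).
Proof.
move=> xi0; apply: (reflexive_pairing R_artin J_min
  (B := fun f d => theta A (pull E f d)) (T_fin _ _)).
- by move=> f a d d'; rewrite pull_lin linearP.
- by move=> d a f f'; rewrite pull_linm linearP.
- exact: theta_rep.
- by move=> f Hf; apply/xi0/theta_proj.
Qed.

(** Embed [X] into an injective with third term [Y] and class [d]. On morphisms C -> Y, [xi] is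
    given by some [psi] in E(Y, tau C), which pulls back to 0 on the injective and so is c_* d. *)
Lemma theta_push_rep (C X : T) (xi : {linear E C X -> J}) :
  exists c : mor X (tau C), forall e, xi e = theta C (push E c e).
Proof.
have [Y [d [s [ds sI]]]] := TI X.
have [|psi psiE] :=
  theta_pull_reflexive (A := C) (B := Y) (xi := xi \o lin_of (pull_linm d)).
  by move=> f Pf /=; rewrite Pf linear0.
have [|c cE] := ext_push_sfst0 TE ds (e := psi).
  apply: theta_pull_sep => g; rewrite -pull_comp -psiE /= pull_comp.
  by rewrite (tri_pull0 TE ds) pull0 linear0.
exists c => e; have [f <-] := pull_of_hull TE e ds sI.
by rewrite push_pull cE -psiE.
Qed.

Lemma theta_push_inj (C X : T) (c : mor X (tau C)) :
  (forall e : E C X, theta C (push E c e) = 0) -> inj_ideal T X (tau C) c.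
Proof.
move=> Hc Y e; apply: theta_pull_sep => f.
by rewrite -push_pull.
Qed.

Lemma theta_push_sep (C X : T) (e : E C X) :
  (forall c : mor X (tau C), theta C (push E c e) = 0) -> e = 0.
Proof.
move=> He; apply: (separation J_min (T_fin _ _)) => g.
by have [c ->] := theta_push_rep g.
Qed.

Lemma theta_push_reflexive (C X : T) (xi : {linear mor X (tau C) -> J}) :
  (forall c, inj_ideal T X (tau C) c -> xi c = 0) ->
  exists e : E C X, forall c, xi c = theta C (push E c e).
Proof.
move=> xi0; apply: (reflexive_pairing R_artin J_min
  (B := fun c e => theta C (push E c e)) (T_fin _ _)).
- by move=> c a e e'; rewrite push_lin linearP.
- by move=> e a c c'; rewrite push_linm linearP.
- exact: theta_push_rep.
- by move=> c Hc; apply/xi0/theta_push_inj.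
Qed.

(** The relation between [d] and phi(d). *)
Definition corresponds (C A : T) (d : E C A) (d' : E (tau C) (tau A)) : Prop :=
  forall f : mor A (tau C), theta A (pull E f d') = theta C (push E f d).

Lemma corresponds_lin (C A : T) (d1 d2 : E C A) d1' d2' a :
  corresponds d1 d1' -> corresponds d2 d2' ->
  corresponds (a *: d1 + d2) (a *: d1' + d2').
Proof. by move=> H1 H2 f; rewrite pull_lin push_lin !linearP H1 H2. Qed.

Lemma corresponds_fun (C A : T) (d : E C A) d1' d2' :
  corresponds d d1' -> corresponds d d2' -> d1' = d2'.
Proof.
move=> H1 H2; apply/eqP; rewrite -subr_eq0; apply/eqP/theta_pull_sep => f.
by rewrite pullB linearB H1 H2 subrr.
Qed.

Lemma corresponds_inj (C A : T) (d1 d2 : E C A) d' :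
  corresponds d1 d' -> corresponds d2 d' -> d1 = d2.
Proof.
move=> H1 H2; apply/eqP; rewrite -subr_eq0; apply/eqP/theta_push_sep => f.
by rewrite pushB linearB -H1 -H2 subrr.
Qed.

Lemma corresponds_push (C A A' : T) (a : mor A A') (d : E C A) d' :
  corresponds d d' -> corresponds (push E a d) (push E (tm a) d').
Proof.
move=> H f; rewrite -push_pull theta_nat -pull_comp H.
by rewrite push_comp.
Qed.

Lemma corresponds_pull (C C' A : T) (c : mor C' C) (d : E C A) d' :
  corresponds d d' -> corresponds (pull E c d) (pull E (tm c) d').
Proof.
by move=> H f; rewrite -pull_comp H push_comp theta_nat push_pull.
Qed.

(** The functional theta_C (f_* d) of [f] vanishes on maps through projectives because [d] is in
    E^Q; its representative is in E_J because E(C, I) = 0 for [I] injective. *)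
Lemma corresponds_total (C A : T) (d : E C A) :
  ext_upper (projective T) C A d ->
  exists d', ext_lower (injective_obj T) (tau C) (tau A) d' /\ corresponds d d'.
Proof.
move=> dU.
have [|d' d'E] := theta_pull_reflexive (xi := theta C \o lin_of (push_linm d)).
  by move=> f Pf /=; rewrite (upper_push0 TE TP dU) // linear0.
exists d'; split=> [I j I_inj|f]; last by rewrite -d'E.
apply: theta_pull_sep => g; rewrite -pull_comp -d'E /= push_comp.
by rewrite [push E g d]I_inj push0 linear0.
Qed.

Lemma corresponds_surj (C A : T) (d' : E (tau C) (tau A)) :
  ext_lower (injective_obj T) (tau C) (tau A) d' ->
  exists d, ext_upper (projective T) C A d /\ corresponds d d'.
Proof.
move=> dL.
have [|d dE] := theta_push_reflexive (xi := theta A \o lin_of (pull_linm d')).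
  move=> f /(inj_idealE TE TI)[I [g [h [I_inj ->]]]] /=.
  by rewrite pull_comp dL // pull0 linear0.
exists d; split=> [Q j PQ|f]; last by rewrite -dE.
apply: theta_push_sep => g; rewrite -push_comp -dE /= pull_comp.
by rewrite [pull E g d']PQ pull0 linear0.
Qed.

(** * The comparison morphism between realizations *)

Section Realization.
Variables (C A : T) (d : E C A) (d' : E (tau C) (tau A)).
Variables (s : sequence A C) (s' : sequence (tau A) (tau C)).
Hypotheses (ds : real T d s) (ds' : real T d' s').
Hypotheses (dU : ext_upper (projective T) C A d) (dd' : corresponds d d').
Local Notation x := (sfst s).
Local Notation y := (ssnd s).
Local Notation p := (sfst s').
Local Notation q := (ssnd s').

Lemma comparison_exists : exists b : mor (mid s') (tau (mid s)),
  inj_ideal T _ _ (b \@ p - tm x) /\ inj_ideal T _ _ (tm y \@ b - q).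
Proof.
have f_lin : linear (fun w : (E (mid s) (tau A) * E C (mid s'))%type =>
    push E p w.1 + pull E y w.2).
  by move=> a w w' /=; rewrite push_lin pull_lin scalerDr addrACA.
have h_lin : linear (fun w : (E (mid s) (tau A) * E C (mid s'))%type =>
    theta A (pull E x w.1) + theta C (push E q w.2)).
  by move=> a w w' /=; rewrite push_lin pull_lin !linearP scalerDr addrACA.
have [|g gE] := extension R_artin J_min (f := lin_of f_lin) (h := lin_of h_lin)
  (T_fin _ _).
  move=> w; rewrite !lin_ofE.
  move=> /(connecting_morphism TE TI ds ds')[f [<- fd]].
  by rewrite dd' fd linearN addNr.
have [b bE] := theta_push_rep g; exists b; split; apply: theta_push_inj => e.
  rewrite pushBm linearB push_comp -bE theta_nat.
  have := gE (e, 0); rewrite !lin_ofE /= pull0 push0 linear0 !addr0 => ->.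
  by rewrite subrr.
rewrite pushBm linearB push_comp theta_nat -push_pull -bE.
have := gE (0, e); rewrite !lin_ofE /= pull0 push0 linear0 !add0r => ->.
by rewrite subrr.
Qed.

Variable b : mor (mid s') (tau (mid s)).
Hypotheses (bp : inj_ideal T _ _ (b \@ p - tm x)).
Hypotheses (yb : inj_ideal T _ _ (tm y \@ b - q)).

Let push_bp X (u : E X (tau A)) : push E b (push E p u) = push E (tm x) u.
Proof. by apply/eqP; rewrite -subr_eq0 -push_comp -pushBm bp. Qed.

Let push_yb X (e : E X (mid s')) : push E (tm y) (push E b e) = push E q e.
Proof. by apply/eqP; rewrite -subr_eq0 -push_comp -pushBm yb. Qed.

(** Here e = p_* u with [tm x] killing [u]. The functional theta_A (f^* u) of [f] depends only on
    f_* d, so it extends to E(C, X) and is represented by some [c]; hence u = c^* d', which [p]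
    kills. *)
Lemma comparison_inj X (e : E X (mid s')) : push E b e = 0 -> e = 0.
Proof.
move=> be; have [|u uE] := ext_push_exact TE (e := e) ds'.
  by rewrite -push_yb be push0.
have xu : push E (tm x) u = 0 by rewrite -push_bp uE.
have [f fd|g gE] := extension R_artin J_min (f := lin_of (push_linm d))
  (h := theta A \o lin_of (pull_linm u)) (T_fin C X).
  have [g <-] := factor_sfst TE ds fd.
  by rewrite /= pull_comp -theta_nat push_pull xu pull0 linear0.
have [c cE] := theta_push_rep g.
have -> : e = push E p (pull E c d').
  rewrite -uE; congr (push E p _); apply/eqP; rewrite -subr_eq0.
  apply/eqP/theta_pull_sep => f.
  rewrite pullB linearB -pull_comp dd' push_comp -cE.
  by rewrite [g _]gE subrr.
by rewrite push_pull (tri_push0 TE ds') pull0.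
Qed.

(** Testing on functionals shows that the pullback along [h] of a projective
    cover of [X] is a pushout of [d], so it dies on [y]. *)
Lemma stable_comp_ssnd0 X (h : mor C X) :
  inj_ideal T _ _ (tm h \@ q) -> proj_ideal T _ _ (h \@ y).
Proof.
move=> hq; have [O [pi [c [pi_c c_proj]]]] := TP X.
have [I [N [K [m [n [iota [u [k [l [kappa [I_inj ri rk ru [uk _ _ _]]]]]]]]]]]]
  := hull_octahedron TE TI ds'.
have [|t /= tE] := factor_sfst TE ru (f := tm h); first by rewrite -push_comp hq.
have [f fE] : limage (lin_of (push_linm d)) (pull E h pi).
  apply: (separation_mod J_min (T_fin _ _)) => g g0.
  have [w wE] := theta_push_rep g.
  have wd' : pull E w d' = 0.
    apply: theta_pull_sep => f; rewrite -pull_comp dd' push_comp -wE.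
    by apply: g0; exists f.
  (* [u \@ w] pulls [kappa] back to w^* d' = 0, and [kappa] has an injective middle term. *)
  have uw : inj_ideal T _ _ (u \@ w).
    by apply: (inj_ideal_pull_hull TE TI rk I_inj); rewrite pull_comp uk.
  rewrite wE push_pull -theta_nat -tE push_comp -[push E u _]push_comp uw.
  by rewrite push0 linear0.
have [|g gE] := factor_ssnd TE pi_c (f := h \@ y).
  by rewrite pull_comp fE /= -push_pull (tri_pull0 TE ds) push0.
by apply/proj_idealE => //; exists (mid c), g, (ssnd c).
Qed.

Lemma comparison_surj X (z : E X (tau (mid s))) : exists e, push E b e = z.
Proof.
(* A functional killing the image of [q] is given by some [h] with [tm h \@ q] zero modulo
   injectives; then [h \@ y] is zero modulo projectives. *)
have [e /= eE] : limage (lin_of (@push_lin _ _ _ E X _ _ q)) (push E (tm y) z).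
  apply: (separation_mod J_min (T_fin _ _)) => g g0.
  have [h hE] := theta_rep g.
  have hq : inj_ideal T _ _ (tm h \@ q).
    apply: theta_push_inj => e; rewrite push_comp theta_nat -hE.
    by apply: g0; exists e.
  have hy := stable_comp_ssnd0 hq.
  by rewrite hE -push_pull theta_nat -pull_comp hy linear0.
have ze : push E (tm y) (z - push E b e) = 0 by rewrite pushB push_yb eE subrr.
(* Functionals killing the image of [tm x] come from maps [r] that factor through [y] modulo
   projectives. *)
have [u /= uE] : limage (lin_of (@push_lin _ _ _ E X _ _ (tm x))) (z - push E b e).
  apply: (separation_mod J_min (T_fin _ _)) => g g0.
  have [r rE] := theta_rep g.
  have rx : proj_ideal T _ _ (r \@ x).
    apply: theta_proj => u; rewrite pull_comp -theta_nat push_pull -rE.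
    by apply: g0; exists u.
  have [h hE] := stable_weak_cokernel TE TP ds dU rx.
  rewrite rE; have := hE _ (z - push E b e); rewrite pullBm => /subr0_eq ->.
  by rewrite pull_comp -theta_nat push_pull ze pull0 linear0.
exists (e + push E p u).
by rewrite -[LHS]/(lin_of (push_lin b) _) linearD /= push_bp -uE addrC subrK.
Qed.

End Realization.
End Duality.

(** * Lifting the duality from the quotients *)

Section Assembly.
Variables (R : comPzRingType) (J : lmodType R) (T : extri_data R).
Variable ars : right_ARS_duality J T.
Local Notation E := (eext T).

Definition ars_obj (X : T) : T := ars_tau ars X.

Definition ars_lift (A B : T) (f : mor A B) : mor (ars_obj A) (ars_obj B) :=
  rep (fmap (ars_tau ars) (cl (proj_ideal T A B) f : @mor R (stable T) A B)).

Definition ars_theta (C : T) : {linear E C (ars_obj C) -> J} :=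
  ars_eta ars C C (@idm R (stable T) C).

Lemma cl_ars_lift (A B : T) (f : mor A B) :
  cl (inj_ideal T (ars_obj A) (ars_obj B)) (ars_lift f) =
  fmap (ars_tau ars) (cl (proj_ideal T A B) f : @mor R (stable T) A B).
Proof. exact: repK. Qed.

(** Yoneda: naturality in [B], at the identity of [A]. *)
Lemma ars_eta_pull (A B : T) (f : mor A B) (d : E B (ars_obj A)) :
  homm_fun (ars_eta ars A B (cl (proj_ideal T A B) f : @mor R (stable T) A B)) d =
  ars_theta A (pull E f d).
Proof.
have := ars_eta_nat (r := ars) (@idm R (stable T) A) (cl (proj_ideal T A B) f)
  (@idm R (stable T) A) d.
rewrite !compm1 fmap1 push1 => H; apply: etrans H _.
by congr (ars_theta A _); apply: quot_pullE.
Qed.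

Lemma ars_theta_nat (A B : T) (f : mor A B) (d : E B (ars_obj A)) :
  ars_theta B (push E (ars_lift f) d) = ars_theta A (pull E f d).
Proof.
rewrite -ars_eta_pull.
have := ars_eta_nat (r := ars) (cl (proj_ideal T A B) f) (@idm R (stable T) B)
  (@idm R (stable T) B) d.
by rewrite !comp1m pull1 => H; apply: etrans (esym H) _.
Qed.

Lemma ars_theta_rep (A B : T) (g : {linear E B (ars_obj A) -> J}) :
  exists f : mor A B, forall d, g d = ars_theta A (pull E f d).
Proof.
have [inv _ invK] := ars_eta_bij ars A B.
exists (rep (inv g)) => d; rewrite -ars_eta_pull.
have -> : cl (proj_ideal T A B) (rep (inv g)) = inv g by apply: repK.
by rewrite invK.
Qed.

Lemma ars_theta_proj (A B : T) (f : mor A B) :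
  (forall d : E B (ars_obj A), ars_theta A (pull E f d) = 0) -> proj_ideal T A B f.
Proof.
move=> Hf; rewrite -[f]subr0; apply/cl_eqP; rewrite cl0.
apply: (bij_inj (ars_eta_bij ars A B)); rewrite linear0.
by apply: hommP => d; rewrite ars_eta_pull Hf.
Qed.

Lemma ars_tau_fully_faithful (T_fin : Ext_finite T)
    (J_min : minimal_injective_cogenerator J) : fully_faithful (ars_tau ars).
Proof.
move=> A B.
have faith (f g : @mor R (stable T) A B) :
    fmap (ars_tau ars) f = fmap (ars_tau ars) g -> f = g.
  rewrite -(repK f) -(repK g) => fg; apply/cl_eqP.
  apply: (tm_faithful ars_theta_nat ars_theta_proj).
  rewrite -[ars_lift _]subr0; apply/cl_eqP; rewrite cl0 cl_ars_lift clB linearB.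
  by rewrite fg subrr.
have full (h : mor (ars_tau ars A) (ars_tau ars B)) :
    exists f : @mor R (stable T) A B, fmap (ars_tau ars) f = h.
  have [f fE] := tm_full J_min T_fin ars_theta_nat ars_theta_rep (rep h).
  exists (cl (proj_ideal T A B) f); rewrite -cl_ars_lift -[RHS]repK.
  exact/esym/cl_eqP.
have [inv invK] := choice full.
by exists inv => [f|//]; apply: faith.
Qed.

End Assembly.

(** * The natural isomorphism phi and exactness *)

Section ExactEquivalence.
Variables (R : comPzRingType) (R_artin : artinian R).
Variables (J : lmodType R) (J_min : minimal_injective_cogenerator J).
Variables (T : extri_data R) (TE : extriangulated T) (T_fin : Ext_finite T).
Variable ars : right_ARS_duality J T.
Variables (TP : enough_projectives T) (TI : enough_injectives T).

Local Notation upper C A := (subm (ext_upper (projective T) C A)).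
Local Notation lower C A := (subm (ext_lower (injective_obj T) C A)).
Local Notation tau := (ars_obj ars).

Let nat := ars_theta_nat (ars := ars).
Let repr := ars_theta_rep (ars := ars).
Let proj := ars_theta_proj (ars := ars).

Lemma phi_exists (C A : T) (d : upper C A) :
  exists d' : lower (tau C) (tau A),
    corresponds (ars_theta ars) (subm_val d) (subm_val d').
Proof.
have [d' [d'L dd']] :=
  corresponds_total R_artin J_min TE T_fin TP repr proj (subm_mem d).
by exists (mk_subm d'L).
Qed.

Definition phi_fun (C A : T) (d : upper C A) : lower (tau C) (tau A) :=
  sval (cid (phi_exists d)).

Lemma phi_corr (C A : T) (d : upper C A) :
  corresponds (ars_theta ars) (subm_val d) (subm_val (phi_fun d)).
Proof. exact: svalP (cid (phi_exists d)). Qed.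

Lemma phi_eq (C A : T) (d : upper C A) (d' : lower (tau C) (tau A)) :
  corresponds (ars_theta ars) (subm_val d) (subm_val d') -> phi_fun d = d'.
Proof.
move=> dd'; apply: val_inj.
exact: (corresponds_fun J_min T_fin repr (phi_corr d) dd').
Qed.

Lemma phi_linear (C A : T) : linear (@phi_fun C A).
Proof.
move=> a d1 d2; apply: phi_eq.
exact: (corresponds_lin a (phi_corr d1) (phi_corr d2)).
Qed.

Lemma phi_bijective (C A : T) : bijective (@phi_fun C A).
Proof.
have surj (d' : lower (tau C) (tau A)) : exists d, phi_fun d = d'.
  have [d [dU dd']] := corresponds_surj R_artin J_min TE T_fin TI repr proj
    (subm_mem d').
  by exists (mk_subm dU); apply: phi_eq.
have [inv invK] := choice surj; exists inv => // d; apply: val_inj.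
apply: (corresponds_inj R_artin J_min TE T_fin TI repr proj (phi_corr _)).
by rewrite invK; apply: phi_corr.
Qed.

Definition ars_phi : bifun_trans (eext (stable_extri TE TP))
  (bifun_comp (eext (costable_extri TE TI)) (ars_tau ars) (ars_tau ars)).
Proof.
refine (@BifunTrans R (stable_extri TE TP) (stable_extri TE TP)
  (eext (stable_extri TE TP))
  (bifun_comp (eext (costable_extri TE TI)) (ars_tau ars) (ars_tau ars))
  (fun C A => lin_of (@phi_linear C A)) _ _).
(* The class [c] acts through [rep c], and its image under tau through [ars_lift (rep c)]. *)
- move=> C C' A c d; apply: phi_eq.
  have := corresponds_pull nat (rep c) (phi_corr d).
  by rewrite /ars_lift repK.
- move=> C A A' a d; apply: phi_eq.
  have := corresponds_push nat (rep a) (phi_corr d).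
  by rewrite /ars_lift repK.
Defined.

Lemma ars_phi_exact : @exact_functor R (stable_extri TE TP) (costable_extri TE TI)
  (ars_tau ars) ars_phi.
Proof.
move=> C A d t [s [ds st]].
have [s' ds'] := real_class (subm_val (phi_fun d)).
have {}ds' : real T (subm_val (phi_fun d)) s' by rewrite ds'; apply: seq_equiv_refl.
(* It remains to identify [s'] with the image of [s] modulo injectives; [st] transports this to
   [t]. *)
exists s'; split=> //.
apply: seq_equiv_trans (map_sequence_equiv (ars_tau ars) st).
have dU := subm_mem d; have dd' := phi_corr d.
have [b [bp yb]] :=
  comparison_exists R_artin J_min TE T_fin TI nat repr proj ds ds' dd'.
have [||b' [b'b bb']] := costable_iso TE TI (b := b).
- exact: (comparison_inj R_artin J_min TE T_fin TI nat repr proj ds ds' dd' bp yb).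
- exact: (comparison_surj R_artin J_min TE T_fin TP TI nat repr proj
    ds ds' dU dd' bp yb).
exists (cl (inj_ideal T _ _) b); split.
- exists (cl (inj_ideal T _ _) b'); split; rewrite [LHS]quot_compE; exact/cl_eqP.
- rewrite [LHS]quot_compE /= -cl_ars_lift; exact/cl_eqP.
- rewrite /= -cl_ars_lift [LHS]quot_compE; exact/cl_eqP.
Qed.

End ExactEquivalence.

Theorem theorem1p2 (R : comPzRingType) (R_artin : artinian R)
  (J : lmodType R) (J_min : minimal_injective_cogenerator J)
  (T : extri_data R) (TE : extriangulated T)
  (T_fin : Ext_finite T) (T_wic : weakly_idempotent_complete T)
  (ars : right_ARS_duality J T)
  (TP : enough_projectives T) (TI : enough_injectives T)
  (Q_ff : functorially_finite (projective T))
  (J_ff : functorially_finite (injective_obj T)) :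
  exists phi : bifun_trans (eext (stable_extri TE TP))
      (bifun_comp (eext (costable_extri TE TI)) (ars_tau ars) (ars_tau ars)),
    is_bifun_iso phi /\
    @exact_functor R (stable_extri TE TP) (costable_extri TE TI)
      (ars_tau ars) phi /\
    fully_faithful (ars_tau ars).
Proof.
exists (ars_phi R_artin J_min TE T_fin ars TP TI); split.
  by move=> C A; apply: (phi_bijective R_artin J_min TE T_fin ars TP TI).
by split; [apply: ars_phi_exact|apply: ars_tau_fully_faithful].
Qed.
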